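(* Let $\mathrm F_2=\langle m,n\rangle$ be a free group of rank two and let $\rho:\mathrm F_2\to\mathrm{SU}(3,1)$ be a representation such that $\rho(m),\rho(n)$ are loxodromic and generate a non-singular subgroup of $\mathrm{SU}(3,1)$. Then for some $i,j\in\{1,2\}$ there exist two non-zero complex parameters $\alpha_i=\alpha_i(\rho(m),\rho(n))$ and $\beta_j=\beta_j(\rho(m),\rho(n))$ such that these, along with the coefficients of the characteristic polynomials of $\rho(m)$ and $\rho(n)$ and the point $(\mathbb X_1,\mathbb X_2,\mathbb X_3)(\rho(m),\rho(n))$ of the cross-ratio variety, completely determine $\rho$ up to conjugacy in $\mathrm{SU}(3,1)$ (that is, any $\rho'$ in $\mathcal R_{ij}^{lox}$ with the same parameters is conjugate to $\rho$). The real dimension of the parameter space associated to $\mathcal M_{ij}^{lox}$ is $15$.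
   Context: $\mathbb C^{3,1}$ is $\mathbb C^4$ with the Hermitian form $\langle z,w\rangle=z_1\bar w_4+z_2\bar w_2+z_3\bar w_3+z_4\bar w_1$ of signature $(3,1)$; $\mathrm{SU}(3,1)$ is the group of determinant-one matrices preserving it. A vector $v\ne0$ is positive, null or negative according to the sign of $\langle v,v\rangle$. $\mathbf H^3_{\mathbb C}$ is the projectivization of the negative vectors, and $\partial\mathbf H^3_{\mathbb C}$ is the projectivization of the null vectors. A $\mathbb C^2$-plane is the projectivization (in $\mathbf H^3_{\mathbb C}$) of a copy of $\mathbb C^{2,1}$; a $\mathbb C^2$-chain is the boundary of a $\mathbb C^2$-plane. The $\mathbb C^2$-chain polar to a positive vector $c$ is the set of points of $\partial\mathbf H^3_{\mathbb C}$ represented by null vectors in $c^\perp$. An element $A\in\mathrm{SU}(3,1)$ is loxodromic if it fixes no point of $\mathbf H^3_{\mathbb C}$ and exactly two points of $\partial\mathbf H^3_{\mathbb C}$. Its eigenvalues are $re^{i\theta},r^{-1}e^{i\theta},e^{i\phi},e^{-i(2\theta+\phi)}$ with $r>1$, $\theta,\phi\in(-\pi,\pi]$. $\mathbf a_A,\mathbf r_A$ denote null eigenvectors for $re^{i\theta}$, $r^{-1}e^{i\theta}$, and $\mathbf x_A,\mathbf y_A$ denote mutually orthogonal positive eigenvectors for $e^{i\phi}$, $e^{-i(2\theta+\phi)}$ respectively, normalized to $\langle\mathbf x_A,\mathbf x_A\rangle=\langle\mathbf y_A,\mathbf y_A\rangle=1$. The labelling (which of the two unit-modulus eigenvalues is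 called $e^{i\phi}$) is a fixed convention depending only on the set of eigenvalues; if the two coincide, $\mathbf x_A,\mathbf y_A$ is a chosen orthonormal basis of the positive eigenspace. The characteristic polynomial of $A\in\mathrm{SU}(3,1)$ is $X^4-\tau X^3+\sigma X^2-\bar\tau X+1$ with $\tau=\mathrm{tr}(A)\in\mathbb C$ and $\sigma=\sigma(A)=\frac12(\mathrm{tr}^2(A)-\mathrm{tr}(A^2))\in\mathbb R$. For vectors put $\mathbb X(z_1,z_2,z_3,z_4)=[z_1,z_2,z_3,z_4]=\frac{\langle z_3,z_1\rangle\langle z_4,z_2\rangle}{\langle z_4,z_1\rangle\langle z_3,z_2\rangle}$ whenever defined. Then $\mathbb X_1(A,B)=[\mathbf a_B,\mathbf a_A,\mathbf r_A,\mathbf r_B]$, $\mathbb X_2(A,B)=[\mathbf a_B,\mathbf r_A,\mathbf a_A,\mathbf r_B]$, $\mathbb X_3(A,B)=[\mathbf a_A,\mathbf r_A,\mathbf a_B,\mathbf r_B]$. The cross-ratio variety is the set of all triples $(\mathbb X_1,\mathbb X_2,\mathbb X_3)(A,B)\in\mathbb C^3$ arising from pairs of loxodromic elements; its points have five real degrees of freedom. Further $\alpha_1(A,B)=\mathbb X(\mathbf r_A,\mathbf a_A,\mathbf x_B,\mathbf a_B)$, $\alpha_2(A,B)=\mathbb X(\mathbf r_A,\mathbf a_A,\mathbf y_B,\mathbf a_B)$, $\beta_1(A,B)=\mathbb X(\mathbf r_B,\mathbf a_B,\mathbf x_A,\mathbf a_A)$, $\beta_2(A,B)=\mathbb X(\mathbf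 r_B,\mathbf a_B,\mathbf y_A,\mathbf a_A)$. A pair $(A,B)$ of loxodromic elements is non-singular if: (i) $A$ and $B$ have no common fixed point; (ii) the fixed points of $A$ and $B$ do not lie on a common $\mathbb C^2$-chain; (iii) the fixed-point set (in $\partial\mathbf H^3_{\mathbb C}$) of $A$ is disjoint from at least one of the $\mathbb C^2$-chains polar to $\mathbf x_B,\mathbf y_B$, and the fixed-point set of $B$ is disjoint from at least one of the $\mathbb C^2$-chains polar to $\mathbf x_A,\mathbf y_A$. A free subgroup $\langle A,B\rangle$ is non-singular if the generating pair is. $\mathcal R_{ij}^{lox}$ is the set of $\rho\in\mathrm{Hom}(\mathrm F_2,\mathrm{SU}(3,1))$ such that $\rho(m),\rho(n)$ are loxodromic, $(\rho(m),\rho(n))$ is non-singular, and $\alpha_i(\rho(m),\rho(n))\ne0$, $\beta_j(\rho(m),\rho(n))\neq0$ (both well defined); $\mathcal M_{ij}^{lox}=\mathcal R_{ij}^{lox}/\mathrm{SU}(3,1)$ (quotient by conjugation). The parameter space associated to $\mathcal M_{ij}^{lox}$ is the space in which the parameters $(\mathrm{tr}\,\rho(m),\mathrm{tr}\,\rho(n),\sigma(\rho(m)),\sigma(\rho(n)),(\mathbb X_1,\mathbb X_2,\mathbb X_3),\alpha_i,\beta_j)$ live: two complex traces, two real $\sigma$'s, a point of the cross-ratio variety, and two non-zero complex numbers. *)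

(* Defs.v *)
From HB Require Import structures.
From mathcomp Require Import all_boot all_order all_algebra.
From mathcomp Require Import complex.
From mathcomp Require Import boolp classical_sets reals topology normedtype.
From mathcomp Require Import derive trigo.

Set Implicit Arguments.
Unset Strict Implicit.
Unset Printing Implicit Defensive.

Import Order.TTheory GRing.Theory Num.Theory.
Import numFieldNormedType.Exports.

Local Open Scope classical_set_scope.
Local Open Scope ring_scope.
Local Open Scope complex_scope.

(* Coordinates are numbered from 0, so z_1, ..., z_4 are [z 0 0], ..., [z 3 0]. *)
Definition herm (R : realType) (z w : 'cV[R[i]]_4) : R[i] :=
  z 0 0 * (w 3 0)^* + z 1 0 * (w 1 0)^* + z 2 0 * (w 2 0)^* + z 3 0 * (w 0 0)^*.

(* The order on R[i] makes [c < 0] mean that c is a negative real. *)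
Definition negative (R : realType) (v : 'cV[R[i]]_4) : Prop := herm v v < 0.
Definition null (R : realType) (v : 'cV[R[i]]_4) : Prop :=
  v != 0 /\ herm v v = 0.

Definition is_SU31 (R : realType) (A : 'M[R[i]]_4) : bool :=
  (\det A == 1) && `[< forall z w, herm (A *m z) (A *m w) = herm z w >].

Record SU31 (R : realType) := MkSU31 {
  SU31_mx :> 'M[R[i]]_4;
  SU31_mxP : is_SU31 SU31_mx
}.

HB.instance Definition _ (R : realType) := [isSub for @SU31_mx R].
HB.instance Definition _ (R : realType) := [Choice of SU31 R by <:].

Section SU31_group.
Variable R : realType.
Implicit Types A B : SU31 R.

Lemma SU31_unitmx A : (A : 'M_4) \in unitmx.
Proof. by case: A => A /= /andP[/eqP dA _]; rewrite unitmxE dA unitr1. Qed.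

Fact SU31_one_subproof : is_SU31 (1%:M : 'M[R[i]]_4).
Proof. by rewrite /is_SU31 det1 eqxx; apply/asboolP => z w; rewrite !mul1mx. Qed.

Fact SU31_mul_subproof A B : is_SU31 ((A : 'M_4) *m (B : 'M_4)).
Proof.
case: A B => [A /= /andP[/eqP dA /asboolP hA]] [B /= /andP[/eqP dB /asboolP hB]].
rewrite /is_SU31 det_mulmx dA dB mulr1 eqxx; apply/asboolP => z w.
by rewrite -!mulmxA hA hB.
Qed.

Fact SU31_inv_subproof A : is_SU31 (invmx (A : 'M_4)).
Proof.
have uA := SU31_unitmx A.
case: A uA => [A /= /andP[/eqP dA /asboolP hA]] uA.
rewrite /is_SU31 det_inv dA invr1 eqxx; apply/asboolP => z w.
by rewrite -hA !mulKVmx.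
Qed.

Definition SU31_one : SU31 R := MkSU31 SU31_one_subproof.
Definition SU31_mul A B : SU31 R := MkSU31 (SU31_mul_subproof A B).
Definition SU31_inv A : SU31 R := MkSU31 (SU31_inv_subproof A).

Fact SU31_mulA : associative SU31_mul.
Proof. by move=> A B D; apply: val_inj; rewrite /= mulmxA. Qed.

Fact SU31_mul1 : left_id SU31_one SU31_mul.
Proof. by move=> A; apply: val_inj; rewrite /= mul1mx. Qed.

Fact SU31_mulr1 : right_id SU31_one SU31_mul.
Proof. by move=> A; apply: val_inj; rewrite /= mulmx1. Qed.

Fact SU31_mulV : left_inverse SU31_one SU31_inv SU31_mul.
Proof. by move=> A; apply: val_inj; rewrite /= mulVmx ?SU31_unitmx. Qed.

Fact SU31_mulrV : right_inverse SU31_one SU31_inv SU31_mul.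
Proof. by move=> A; apply: val_inj; rewrite /= mulmxV ?SU31_unitmx. Qed.

End SU31_group.

HB.instance Definition _ (R : realType) := isGroup.Build (SU31 R)
  (@SU31_mulA R) (@SU31_mul1 R) (@SU31_mulr1 R) (@SU31_mulV R) (@SU31_mulrV R).

(* A point of projective space is represented by any of its nonzero lifts, and
   a set of points of the boundary by the set of all null lifts of its points. *)
Definition proportional (R : realType) (v w : 'cV[R[i]]_4) : Prop :=
  exists2 c : R[i], c != 0 & v = c *: w.

Definition fixes (R : realType) (A : SU31 R) (v : 'cV[R[i]]_4) : Prop :=
  exists c : R[i], A *m v = c *: v.

Definition boundary_fixed (R : realType) (A : SU31 R) : set 'cV[R[i]]_4 :=
  [set v | null v /\ fixes A v].

Definition loxodromic (R : realType) (A : SU31 R) : Prop :=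
  (forall v, negative v -> ~ fixes A v) /\
  exists u v, [/\ boundary_fixed A u, boundary_fixed A v, ~ proportional u v &
    forall w, boundary_fixed A w -> proportional w u \/ proportional w v].

Definition expi (R : realType) (t : R) : R[i] := cos t +i* sin t.

(* A choice, for each loxodromic A, of r, theta, phi and of the eigenvectors
   a_A, r_A, x_A, y_A. The last field says that the labelling of the two
   unit-modulus eigenvalues depends only on the set of eigenvalues. Values at
   elements that are not loxodromic are irrelevant. *)
Record eigenframe (R : realType) := Eigenframe {
  ef_mod : SU31 R -> R;
  ef_theta : SU31 R -> R;
  ef_phi : SU31 R -> R;
  attr : SU31 R -> 'cV[R[i]]_4;
  repl : SU31 R -> 'cV[R[i]]_4;
  xvec : SU31 R -> 'cV[R[i]]_4;
  yvec : SU31 R -> 'cV[R[i]]_4;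
  ef_modP : forall A, loxodromic A -> 1 < ef_mod A;
  ef_thetaP : forall A, loxodromic A -> - pi < ef_theta A <= pi;
  ef_phiP : forall A, loxodromic A -> - pi < ef_phi A <= pi;
  attrP : forall A, loxodromic A -> null (attr A) /\
    A *m attr A = ((ef_mod A)%:C * expi (ef_theta A)) *: attr A;
  replP : forall A, loxodromic A -> null (repl A) /\
    A *m repl A = (((ef_mod A)^-1)%:C * expi (ef_theta A)) *: repl A;
  xvecP : forall A, loxodromic A -> herm (xvec A) (xvec A) = 1 /\
    A *m xvec A = expi (ef_phi A) *: xvec A;
  yvecP : forall A, loxodromic A -> herm (yvec A) (yvec A) = 1 /\
    A *m yvec A = expi (- (2 * ef_theta A + ef_phi A)) *: yvec A;
  xyvecP : forall A, loxodromic A -> herm (xvec A) (yvec A) = 0;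
  ef_labelling : forall A B, loxodromic A -> loxodromic B ->
    (forall c : R[i], eigenvalue A c = eigenvalue B c) -> ef_phi A = ef_phi B
}.

Definition herm21 (R : realType) (z w : 'cV[R[i]]_3) : R[i] :=
  z 0 0 * (w 2 0)^* + z 1 0 * (w 1 0)^* + z 2 0 * (w 0 0)^*.

(* The columns of M span a copy of C^{2,1} in C^{3,1}. *)
Definition C21_copy (R : realType) (M : 'M[R[i]]_(4, 3)) : Prop :=
  forall z w, herm (M *m z) (M *m w) = herm21 z w.

Definition C2_chain (R : realType) (M : 'M[R[i]]_(4, 3)) : set 'cV[R[i]]_4 :=
  [set v | null v /\ exists z, v = M *m z].

Definition polar_chain (R : realType) (c : 'cV[R[i]]_4) : set 'cV[R[i]]_4 :=
  [set v | null v /\ herm v c = 0].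

Definition non_singular (R : realType) (E : eigenframe R) (A B : SU31 R) : Prop :=
  [/\ ~ (exists v, [/\ negative v \/ null v, fixes A v & fixes B v]),
      ~ (exists M, [/\ C21_copy M, boundary_fixed A `<=` C2_chain M
                     & boundary_fixed B `<=` C2_chain M]),
      boundary_fixed A `&` polar_chain (xvec E B) = set0 \/
      boundary_fixed A `&` polar_chain (yvec E B) = set0
    & boundary_fixed B `&` polar_chain (xvec E A) = set0 \/
      boundary_fixed B `&` polar_chain (yvec E A) = set0].

Definition cross (R : realType) (z1 z2 z3 z4 : 'cV[R[i]]_4) : R[i] :=
  (herm z3 z1 * herm z4 z2) / (herm z4 z1 * herm z3 z2).

Definition cross_defined (R : realType) (z1 z2 z3 z4 : 'cV[R[i]]_4) : Prop :=
  herm z4 z1 * herm z3 z2 != 0.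

Section CrossRatios.
Variables (R : realType) (E : eigenframe R).
Implicit Types A B : SU31 R.

Definition X1 A B := cross (attr E B) (attr E A) (repl E A) (repl E B).
Definition X2 A B := cross (attr E B) (repl E A) (attr E A) (repl E B).
Definition X3 A B := cross (attr E A) (repl E A) (attr E B) (repl E B).

Definition X_defined A B : Prop :=
  [/\ cross_defined (attr E B) (attr E A) (repl E A) (repl E B),
      cross_defined (attr E B) (repl E A) (attr E A) (repl E B)
    & cross_defined (attr E A) (repl E A) (attr E B) (repl E B)].

Definition cross_ratio_variety : set (R[i] * R[i] * R[i]) :=
  [set X | exists A B, [/\ loxodromic A, loxodromic B, X_defined A B
                         & X = (X1 A B, X2 A B, X3 A B)]].

(* The indices 1, 2 of alpha_i, beta_j are the elements 0, 1 of 'I_2. *)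
Definition pvec (i : 'I_2) A := if i == 0 then xvec E A else yvec E A.

Definition alpha i A B := cross (repl E A) (attr E A) (pvec i B) (attr E B).
Definition beta j A B := cross (repl E B) (attr E B) (pvec j A) (attr E A).

Definition alpha_defined i A B : Prop :=
  cross_defined (repl E A) (attr E A) (pvec i B) (attr E B).
Definition beta_defined j A B : Prop :=
  cross_defined (repl E B) (attr E B) (pvec j A) (attr E A).

End CrossRatios.

(* This complex number is in fact real; [Re] only changes its type. *)
Definition sigma (R : realType) (A : SU31 R) : R :=
  complex.Re (2^-1 * ((\tr A) ^+ 2 - \tr ((A : 'M_4) *m (A : 'M_4)))).

Definition free_basis2 (F : groupType) (m n : F) : Prop :=
  forall (G : groupType) (g h : G), exists f : {multiplicative F -> G},
    [/\ f m = g, f n = h & forall f' : {multiplicative F -> G},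
      f' m = g -> f' n = h -> f' =1 f].

Definition conjugate (R : realType) (F : groupType)
    (rho rho' : {multiplicative F -> SU31 R}) : Prop :=
  exists g : SU31 R, forall w : F, rho' w = (g * rho w * g^-1)%g.

Definition R_lox (R : realType) (E : eigenframe R) (F : groupType) (m n : F)
    (i j : 'I_2) : set {multiplicative F -> SU31 R} :=
  [set rho | [/\ loxodromic (rho m), loxodromic (rho n),
                 non_singular E (rho m) (rho n),
                 alpha_defined E i (rho m) (rho n) /\
                 alpha E i (rho m) (rho n) != 0
               & beta_defined E j (rho m) (rho n) /\
                 beta E j (rho m) (rho n) != 0]].

Record parameters (R : realType) := MkParameters {
  par_tr_m : R[i];
  par_tr_n : R[i];
  par_sigma_m : R;
  par_sigma_n : R;
  par_X : R[i] * R[i] * R[i];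
  par_alpha : R[i];
  par_beta : R[i]
}.

Definition parameters_of (R : realType) (E : eigenframe R) (i j : 'I_2)
    (A B : SU31 R) : parameters R :=
  MkParameters (\tr A) (\tr B) (sigma A) (sigma B)
    (X1 E A B, X2 E A B, X3 E A B) (alpha E i A B) (beta E j A B).

(* Two complex traces, two real sigmas, a point of the cross-ratio variety and
   two nonzero complex numbers: the same space for all four pairs (i, j). *)
Definition parameter_space (R : realType) (E : eigenframe R) :
    set (parameters R) :=
  [set p | [/\ cross_ratio_variety E (par_X p), par_alpha p != 0
             & par_beta p != 0]].

Definition real_coordinates (R : realType) (p : parameters R) : 'rV[R]_16 :=
  let re_im (c : R[i]) := [:: complex.Re c; complex.Im c] in
  \row_(k < 16) nth 0 (re_im (par_tr_m p) ++ re_im (par_tr_n p) ++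
    [:: par_sigma_m p; par_sigma_n p] ++
    re_im (par_X p).1.1 ++ re_im (par_X p).1.2 ++ re_im (par_X p).2 ++
    re_im (par_alpha p) ++ re_im (par_beta p)) k.

Definition C1_immersion (R : realType) (d N : nat) (U : set 'rV[R]_d)
    (f : 'rV[R]_d -> 'rV[R]_N) : Prop :=
  [/\ open U, {in U, forall x, differentiable f x},
      {in U, continuous (fun x => jacobian f x : 'M[R]_(d, N))}
    & {in U, forall x, row_free (jacobian f x)}].

Definition contains_submanifold (R : realType) (N : nat) (S : set 'rV[R]_N)
    (d : nat) : Prop :=
  exists (U : set 'rV[R]_d) (f : 'rV[R]_d -> 'rV[R]_N),
    [/\ U !=set0, C1_immersion U f & f @` U `<=` S].

(* The largest dimension of a C^1 submanifold contained in S (immersions are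
   locally embeddings). For semialgebraic S, such as the parameter space, this
   is the usual real dimension. *)
Definition has_real_dimension (R : realType) (N : nat) (S : set 'rV[R]_N)
    (d : nat) : Prop :=
  contains_submanifold S d /\
  forall e, contains_submanifold S e -> (e <= d)%N.

(* Main.v *)
Require Import Defs.
From HB Require Import structures.
From mathcomp Require Import all_boot all_order all_algebra.
From mathcomp Require Import complex.
From mathcomp Require Import boolp classical_sets functions reals topology normedtype.
From mathcomp Require Import derive trigo.
From mathcomp Require Import ring lra.
Set Implicit Arguments.
Unset Strict Implicit.
Unset Printing Implicit Defensive.

Import Order.TTheory GRing.Theory Num.Theory.
Import numFieldNormedType.Exports.

Local Open Scope classical_set_scope.
Local Open Scope ring_scope.

(* Rigidity. Rescaling the null eigenvectors a, r of A and b, s of B so that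
   <r,a> = <s,b> = <b,a> = 1 and |<b,r>| = 1, the three cross-ratios determine
   their Gram matrix up to changing the sign of both q = <b,r> and <s,a>. Triple
   products of null vectors have nonpositive real part, so the other sign would
   force Re q = 0, hence b in the span of a and r. Non-singularity excludes this:
   it makes a, r, b, s a basis, because a nonzero vector orthogonal to all four
   would put them in a copy of C^{2,1}. Equal Gram matrices give an element of
   SU(3,1) carrying one quadruple to the other; beta_j is then a ratio of two
   linear forms that recovers the axis x_A (or y_A), the last axis follows by
   orthogonality, and trace and sigma give the eigenvalues. Likewise for B.

   Dimension. The relation |X2| = |X1| |X3| with X1 <> 0 forbids dimension 16.
   For 15, X1 = P (1 - it), X2 = z P (1 + it), X3 = z is an immersed family with
   five real parameters, realized by explicit null vectors, and any two null
   vectors with nonzero product are the fixed points of a loxodromic element. *)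

(** * Complex conjugation *)

Section Conjugation.
Variable C : numClosedFieldType.
Implicit Types x y : C.

(* On R[i] the generic [rmorph] lemmas may pick the instance of [conjc] instead
   of the one of [Num.conj], whence these restatements. *)
Lemma cjD x y : (x + y)^* = x^* + y^*. Proof. exact: rmorphD. Qed.
Lemma cjN x : (- x)^* = - x^*. Proof. exact: rmorphN. Qed.
Lemma cjM x y : (x * y)^* = x^* * y^*. Proof. exact: rmorphM. Qed.
Lemma cjV x : (x^-1)^* = (x^*)^-1. Proof. exact: fmorphV. Qed.
Lemma cj0 : 0^* = 0 :> C. Proof. exact: rmorph0. Qed.
Lemma cj1 : 1^* = 1 :> C. Proof. exact: rmorph1. Qed.

Definition cjE := (cjD, cjN, cjM, cjV, cj0, cj1, @conjCK C).

End Conjugation.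

(** * The Hermitian form *)

Section HermitianForm.
Variable R : realType.
Local Notation C := (complex R).
Implicit Types (a n r u v w z : 'cV[C]_4) (c : C).

Lemma hermDl u v w : herm (u + v) w = herm u w + herm v w.
Proof. by rewrite /herm !mxE; ring. Qed.

Lemma hermDr u v w : herm w (u + v) = herm w u + herm w v.
Proof. by rewrite /herm !mxE !cjE; ring. Qed.

Lemma hermZl c u w : herm (c *: u) w = c * herm u w.
Proof. by rewrite /herm !mxE; ring. Qed.

Lemma hermZr c u w : herm w (c *: u) = c^* * herm w u.
Proof. by rewrite /herm !mxE !cjE; ring. Qed.

Lemma hermNl u w : herm (- u) w = - herm u w.
Proof. by rewrite -scaleN1r hermZl mulN1r. Qed.

Lemma hermNr u w : herm w (- u) = - herm w u.
Proof. by rewrite -scaleN1r hermZr !cjE mulN1r. Qed.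

Lemma herm_conj u w : herm w u = (herm u w)^*.
Proof. by rewrite /herm !cjE; ring. Qed.

Lemma hermOl w : herm 0 w = 0.
Proof. by rewrite -(scale0r 0) hermZl mul0r. Qed.

Lemma herm0_sym u w : herm u w = 0 -> herm w u = 0.
Proof. by move=> h; rewrite herm_conj h cj0. Qed.

Definition hermE := (hermDl, hermDr, hermNl, hermNr, hermZl, hermZr).

Lemma cV4P u v : u 0 0 = v 0 0 -> u 1 0 = v 1 0 -> u 2 0 = v 2 0 ->
  u 3 0 = v 3 0 -> u = v.
Proof.
move=> h0 h1 h2 h3; apply/colP => k.
case: k => [[|[|[|[|//]]]] Hk]; [move: h0|move: h1|move: h2|move: h3];
  by congr (u _ _ = v _ _); apply: val_inj.
Qed.

(** With equal outer coordinates the two hyperbolic terms merge into [2 * |z 3 0|^2], which leaves a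
    sum of squares. *)
Lemma herm_posdef z : z 0 0 = z 3 0 ->
  0 <= herm z z /\ (herm z z = 0 -> z = 0).
Proof.
move=> h.
have -> : herm z z = 2 * `|z 3 0| ^+ 2 + `|z 1 0| ^+ 2 + `|z 2 0| ^+ 2.
  by rewrite /herm h !normCK; ring.
have p3 : 0 <= 2 * `|z 3 0| ^+ 2 by rewrite mulr_ge0 ?exprn_ge0.
have p1 : 0 <= `|z 1 0| ^+ 2 by rewrite exprn_ge0.
have p2 : 0 <= `|z 2 0| ^+ 2 by rewrite exprn_ge0.
split; first by rewrite !addr_ge0.
move/eqP; rewrite !paddr_eq0 ?addr_ge0 // mulf_eq0 pnatr_eq0 /= !sqrf_eq0 !normr_eq0.
move=> /andP[/andP[/eqP e3 /eqP e1] /eqP e2].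
by apply: cV4P; rewrite ?h ?mxE.
Qed.

Lemma null_neq n : null n -> n 0 0 - n 3 0 != 0.
Proof.
move=> [n0 nn]; apply/eqP => /subr0_eq h.
by have [_ /(_ nn) e] := herm_posdef h; rewrite e eqxx in n0.
Qed.

(* Subtracting a multiple of [n] makes the two outer coordinates of [w] equal
   without changing the square norm; the form is positive definite there. *)
Lemma null_orth n w : null n -> herm w n = 0 ->
  0 <= herm w w /\ (herm w w = 0 -> exists c, w = c *: n).
Proof.
move=> nn h; have nt := null_neq nn.
pose c := (w 0 0 - w 3 0) / (n 0 0 - n 3 0).
have e : herm (w - c *: n) (w - c *: n) = herm w w.
  by rewrite !hermE (herm0_sym h) h (proj2 nn); ring.
have [|p q] := @herm_posdef (w - c *: n).
  by apply/eqP; rewrite -subr_eq0 !mxE /c; apply/eqP; field.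
rewrite -e; split=> // /q /subr0_eq ->; by exists c.
Qed.

(** Used contrapositively: null vectors on distinct boundary points have a nonzero product. *)
Lemma null_orth_null n w : null n -> null w -> herm w n = 0 -> proportional w n.
Proof.
move=> nn [w0 ww] h; have [_ /(_ ww) [c e]] := null_orth nn h.
exists c => //; apply: contra_neq w0 => c0; by rewrite e c0 scale0r.
Qed.

(** In the degenerate case [null_orth] leaves only multiples of [a], and pairing with [r] kills
    these. *)
Lemma hyperbolic_orth a r w : null a -> null r -> herm r a != 0 ->
  herm w a = 0 -> herm w r = 0 -> 0 <= herm w w /\ (herm w w = 0 -> w = 0).
Proof.
move=> na nr ra wa wr; have [p q] := null_orth na wa; split=> // /q [c e].
move: wr; rewrite e hermZl herm_conj => /eqP; rewrite mulf_eq0 conjC_eq0 (negPf ra) orbF.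
by move/eqP->; rewrite scale0r.
Qed.

End HermitianForm.

(** * Frames, Gram matrices and isometries *)

Lemma sum4 (V : nmodType) (F : 'I_4 -> V) : \sum_i F i = F 0 + F 1 + F 2 + F 3.
Proof.
rewrite !big_ord_recl big_ord0 addr0 !addrA.
by congr (_ + F _ + F _ + F _); apply: val_inj.
Qed.

Section Frames.
Variable R : realType.
Local Notation C := (complex R).
Implicit Types (a b c d v w : 'cV[C]_4).

Definition frame a b c d : 'M[C]_4 :=
  \matrix_(i < 4, j < 4) (nth 0 [:: a; b; c; d] j) i 0.

Lemma mul_frame a b c d (u : 'cV[C]_4) :
  frame a b c d *m u = u 0 0 *: a + u 1 0 *: b + u 2 0 *: c + u 3 0 *: d.
Proof.
apply/colP => i; rewrite !mxE sum4 !mxE /=.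
by ring.
Qed.

Lemma unit_of_inj (F : 'M[C]_4) :
  (forall u : 'cV[C]_4, F *m u = 0 -> u = 0) -> F \in unitmx.
Proof.
move=> h; rewrite -unitmx_tr -row_free_unit; apply: inj_row_free => v hv.
by apply: trmx_inj; rewrite trmx0; apply: h; rewrite -[F]trmxK -trmx_mul hv trmx0.
Qed.

Lemma frame_span a b c d v : frame a b c d \in unitmx ->
  exists k1 k2 k3 k4, v = k1 *: a + k2 *: b + k3 *: c + k4 *: d.
Proof.
move=> F; rewrite -(mulKVmx F v) mul_frame.
by do 4!eexists.
Qed.

Lemma herm_nondeg w : (forall v, herm w v = 0) -> w = 0.
Proof.
move=> h; have e k l : (delta_mx k 0 : 'cV[C]_4) l 0 = (l == k)%:R.
  by rewrite mxE eqxx andbT.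
apply: cV4P; rewrite [RHS]mxE.
- by have := h (delta_mx 3 0); rewrite /herm !e /= !cjE !mulr0 mulr1 !addr0.
- by have := h (delta_mx 1 0); rewrite /herm !e /= !cjE !mulr0 mulr1 !addr0 add0r.
- by have := h (delta_mx 2 0); rewrite /herm !e /= !cjE !mulr0 mulr1 !addr0 !add0r.
- by have := h (delta_mx 0 0); rewrite /herm !e /= !cjE !mulr0 mulr1 !add0r.
Qed.

Lemma frame_orth a b c d w : frame a b c d \in unitmx ->
  herm w a = 0 -> herm w b = 0 -> herm w c = 0 -> herm w d = 0 -> w = 0.
Proof.
move=> F wa wb wc wd; apply: herm_nondeg => v.
have [k1 [k2 [k3 [k4 ->]]]] := frame_span v F.
by rewrite !hermE wa wb wc wd !mulr0 !addr0.
Qed.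

(** A nonzero row in the left kernel is a linear form vanishing on the four vectors. Conjugating its
    entries and swapping the outer two turns it into the product with a vector [w]. *)
Lemma singular_orth a b c d : frame a b c d \notin unitmx ->
  exists w, [/\ w != 0, herm a w = 0, herm b w = 0, herm c w = 0 & herm d w = 0].
Proof.
rewrite -row_free_unit -kermx_eq0 => /rowV0Pn [u /sub_kermxP uF u0].
pose w : 'cV[C]_4 := \col_i [:: (u 0 3)^*; (u 0 1)^*; (u 0 2)^*; (u 0 0)^*]`_i.
have hw v : herm v w = \sum_j u 0 j * v j 0.
  rewrite /herm !mxE /= !conjCK sum4.
  by ring.
have F0 k : \sum_j u 0 j * frame a b c d j k = 0.
  by have := congr1 (fun M : 'rV__ => M 0 k) uF; rewrite !mxE.
exists w; split; rewrite ?hw.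
- apply: contra_neq u0 => w0; apply/rowP => k; rewrite mxE.
  have e (l : 'I_4) : w l 0 = 0 by rewrite w0 mxE.
  have := (e 0, e 1, e 2, e 3); rewrite !mxE /= => -[[[]]].
  move=> /eqP h3 /eqP h1 /eqP h2 /eqP h0.
  move: h0 h1 h2 h3; rewrite !conjC_eq0 => /eqP h0 /eqP h1 /eqP h2 /eqP h3.
  case: k => [[|[|[|[|//]]]] Hk]; [move: h0|move: h1|move: h2|move: h3];
    by congr (u _ _ = 0); apply: val_inj.
- by rewrite -[RHS](F0 0); apply: eq_bigr => j _; rewrite !mxE.
- by rewrite -[RHS](F0 1); apply: eq_bigr => j _; rewrite !mxE.
- by rewrite -[RHS](F0 2); apply: eq_bigr => j _; rewrite !mxE.
- by rewrite -[RHS](F0 3); apply: eq_bigr => j _; rewrite !mxE.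
Qed.

(** The matrix of [herm] in the standard basis: the permutation matrix exchanging coordinates 0 and
    3. *)
Definition gram : 'M[C]_4 := \matrix_(i < 4, j < 4) (nth 0%N [:: 3; 1; 2; 0]%N i == j)%:R.

Lemma gramE (A B : 'M[C]_4) i j :
  (A^T *m gram *m map_mx Num.conj B) i j = herm (col i A) (col j B).
Proof.
rewrite /herm !mxE sum4 !mxE !sum4 !mxE /=.
by ring.
Qed.

(** Invariance says that [g^T], [gram] and the conjugate of [g] multiply to [gram]. Taking
    determinants gives [|\det g|^2 = 1], since [gram] is an involution and so has nonzero
    determinant. *)
Lemma isometry_det (g : 'M[C]_4) :
  (forall z w, herm (g *m z) (g *m w) = herm z w) -> `|\det g| = 1.
Proof.
move=> gP.
have e (A : 'M[C]_4) : (g *m A)^T *m gram *m map_mx Num.conj (g *m A) =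
    A^T *m gram *m map_mx Num.conj A.
  by apply/matrixP => i j; rewrite !gramE !colE -!mulmxA gP.
have det_gram : \det gram != 0.
  have : gram *m gram = 1%:M.
    apply/matrixP => -[[|[|[|[|//]]]] Hi] -[[|[|[|[|//]]]] Hj];
    by rewrite !mxE sum4 !mxE /= ?(mul0r, mulr0, mulr1, add0r, addr0).
  move/(congr1 determinant); rewrite det_mulmx det1 => h.
  by apply: contra_eq_neq h => ->; rewrite mul0r eq_sym oner_eq0.
have := congr1 determinant (e 1%:M).
rewrite !mulmx1 !det_mulmx det_tr det_map_mx trmx1 map_mx1 !det1 !(mul1r, mulr1) => h.
have {}h : \det g * (\det g)^* = 1.
  by apply: (mulIf det_gram); rewrite mul1r -[RHS]h; ring.
by apply/eqP; rewrite -(@pexpr_eq1 _ _ 2) // normCK h.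
Qed.

(** Dividing by a fourth root of the determinant makes the determinant 1; the root has modulus one
    by [isometry_det], so the form is still preserved. *)
Lemma isometry_SU31 (g : 'M[C]_4) :
  (forall z w, herm (g *m z) (g *m w) = herm z w) ->
  exists (h : SU31 R) (k : C), `|k| = 1 /\ forall z : 'cV_4, h *m z = k *: (g *m z).
Proof.
move=> gP; have dg := isometry_det gP.
pose k := 4.-root (\det g)^-1.
have k4 : k ^+ 4 = (\det g)^-1 by exact: rootCK.
have nk : `|k| = 1.
  by apply/eqP; rewrite -(@pexpr_eq1 _ _ 4) // -normrX k4 normfV dg invr1.
have dg0 : \det g != 0 by rewrite -normr_eq0 dg oner_eq0.
have hP : is_SU31 (k *: g).
  apply/andP; split; first by rewrite detZ k4 mulVf.
  apply/asboolP => z w; rewrite -!scalemxAl !hermE gP mulrA -normCK nk.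
  by rewrite expr1n mul1r.
exists (MkSU31 hP), k; split=> //.
by move=> z /=; rewrite -scalemxAl.
Qed.

(** The linear map taking the first frame to the second preserves the products of basis vectors,
    hence the form. One product of each pair is assumed, the other being its conjugate; [k] comes
    from normalizing the determinant. *)
Lemma gram_isometry a b c d a' b' c' d' : frame a b c d \in unitmx ->
  herm a a = herm a' a' -> herm b b = herm b' b' -> herm c c = herm c' c' ->
  herm d d = herm d' d' -> herm b a = herm b' a' -> herm c a = herm c' a' ->
  herm d a = herm d' a' -> herm c b = herm c' b' -> herm d b = herm d' b' ->
  herm d c = herm d' c' ->
  exists (h : SU31 R) (k : C), [/\ k != 0, h *m a = k *: a', h *m b = k *: b',
    h *m c = k *: c' & h *m d = k *: d'].
Proof.
move=> F haa hbb hcc hdd hba hca hda hcb hdb hdc.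
pose F' := frame a' b' c' d'; pose g := F' *m invmx (frame a b c d).
have e (u : 'cV_4) : g *m (frame a b c d *m u) = F' *m u by rewrite /g mulmxA mulmxKV.
have [h [k [nk hk]]] : exists (h : SU31 R) (k : C),
    `|k| = 1 /\ forall z : 'cV_4, h *m z = k *: (g *m z).
  apply: isometry_SU31 => z w.
  rewrite -(mulKVmx F z) -(mulKVmx F w) !e.
  move: (_ *m z) (_ *m w) => u u'; rewrite !mul_frame !hermE.
  rewrite haa hbb hcc hdd hba hca hda hcb hdb hdc.
  rewrite (herm_conj b a) (herm_conj c a) (herm_conj d a).
  rewrite (herm_conj c b) (herm_conj d b) (herm_conj d c).
  rewrite hba hca hda hcb hdb hdc.
  rewrite -(herm_conj b' a') -(herm_conj c' a') -(herm_conj d' a').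
  by rewrite -(herm_conj c' b') -(herm_conj d' b') -(herm_conj d' c').
have ed l : delta_mx l 0 = \col_i (i == l)%:R :> 'cV[C]_4.
  by apply/colP => i; rewrite !mxE eqxx andbT.
exists h, k; split; rewrite ?hk; [by rewrite -normr_eq0 nk oner_eq0|..]; congr (_ *: _).
- have := e (delta_mx 0 0); rewrite !mul_frame ed !mxE /=.
  by rewrite !scale0r !addr0 !scale1r.
- have := e (delta_mx 1 0); rewrite !mul_frame ed !mxE /=.
  by rewrite !scale0r !addr0 !add0r !scale1r.
- have := e (delta_mx 2 0); rewrite !mul_frame ed !mxE /=.
  by rewrite !scale0r !addr0 !add0r !scale1r.
- have := e (delta_mx 3 0); rewrite !mul_frame ed !mxE /=.
  by rewrite !scale0r !add0r !scale1r.
Qed.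
End Frames.

(** * Eigenvectors of loxodromic elements *)

Section EigenData.
Variable R : realType.
Local Notation C := (complex R).
Implicit Types (E : eigenframe R) (A : SU31 R).

Definition ev_mod E A : C := ((ef_mod E A)%:C)%C.
Definition ev_arg E A : C := expi (ef_theta E A).
Definition ev_x E A : C := expi (ef_phi E A).
Definition ev_y E A : C := expi (- (2 * ef_theta E A + ef_phi E A)).

Variable E : eigenframe R.
Implicit Types v w : 'cV[C]_4.

Lemma SU31_herm A v w : herm (A *m v) (A *m w) = herm v w.
Proof. by case: A => A /= /andP[_ /asboolP]. Qed.

Lemma expiJ (t : R) : expi t * (expi t)^* = 1.
Proof.
by rewrite /expi -normCK -add_Re2_Im2 /= cos2Dsin2.
Qed.

Lemma conj_expi (t : R) : (expi t)^* = expi (- t).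
Proof. by rewrite /expi cosN sinN. Qed.

Lemma expiD (t s : R) : expi (t + s) = expi t * expi s.
Proof.
by rewrite /expi cosD sinD [LHS]/=; congr Complex; rewrite addrC [X in X + _]mulrC.
Qed.

Lemma conj_real (r : R) : (r%:C)%C^* = (r%:C)%C.
Proof. by apply/conj_Creal; rewrite complex_real. Qed.

(** Invariance of the form gives [herm v w = c * k^* * herm v w]. *)
Lemma eigen_orth A v w (c k : C) : A *m v = c *: v -> A *m w = k *: w ->
  c * k^* != 1 -> herm v w = 0.
Proof.
move=> Av Aw ck; have := SU31_herm A v w; rewrite Av Aw hermZl hermZr mulrA => h.
apply/eqP; move/eqP: h; rewrite -[X in _ == X]mul1r -subr_eq0 -mulrBl mulf_eq0.
by rewrite subr_eq0 (negPf ck).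
Qed.

Variable A : SU31 R.
Hypothesis loxA : loxodromic A.

Local Notation a_ := (attr E A).
Local Notation r_ := (repl E A).
Local Notation x_ := (xvec E A).
Local Notation y_ := (yvec E A).

Lemma ev_mod_gt1 : 1 < ev_mod E A.
Proof. by rewrite (ltcR 1) ef_modP. Qed.

Lemma ev_mod_neq0 : ev_mod E A != 0.
Proof. by rewrite gt_eqF // (lt_trans ltr01 ev_mod_gt1). Qed.

Lemma ev_modV_lt1 : (ev_mod E A)^-1 < 1.
Proof. by rewrite invf_lt1 ?ev_mod_gt1 // (lt_trans ltr01 ev_mod_gt1). Qed.

Lemma ev_modV : (((ef_mod E A)^-1)%:C)%C = (ev_mod E A)^-1 :> C.
Proof. exact: fmorphV. Qed.

Lemma ev_argJ : ev_arg E A * (ev_arg E A)^* = 1. Proof. exact: expiJ. Qed.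
Lemma ev_xJ : ev_x E A * (ev_x E A)^* = 1. Proof. exact: expiJ. Qed.

Lemma ev_yE : ev_y E A = (ev_arg E A)^* ^+ 2 * (ev_x E A)^*.
Proof. by rewrite /ev_y opprD expiD -!conj_expi mulr_natl mulr2n expiD cjE expr2. Qed.

Lemma attr_eig : A *m a_ = (ev_mod E A * ev_arg E A) *: a_.
Proof. by have [] := attrP E loxA. Qed.
Lemma repl_eig : A *m r_ = ((ev_mod E A)^-1 * ev_arg E A) *: r_.
Proof. by have [_] := replP E loxA; rewrite ev_modV. Qed.
Lemma xvec_eig : A *m x_ = ev_x E A *: x_. Proof. by have [] := xvecP E loxA. Qed.
Lemma yvec_eig : A *m y_ = ev_y E A *: y_. Proof. by have [] := yvecP E loxA. Qed.

Lemma attr_null : null a_. Proof. by have [] := attrP E loxA. Qed.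
Lemma repl_null : null r_. Proof. by have [] := replP E loxA. Qed.

Lemma norm_expi (t : R) : `|expi t| = 1 :> C.
Proof. by apply/eqP; rewrite -(@pexpr_eq1 _ _ 2) // normCK expiJ. Qed.

Lemma norm_ev_mod : `|ev_mod E A| = ev_mod E A.
Proof. by rewrite gtr0_norm // (lt_trans ltr01 ev_mod_gt1). Qed.

Lemma norm_neq1 (c k : C) : `|c| != 1 -> `|k| = 1 -> c * k^* != 1.
Proof.
move=> hc hk; apply: contra_neq hc => /(congr1 Num.norm).
by rewrite normrM norm_conjC hk mulr1 normr1.
Qed.

Lemma norm_ev_attr : `|ev_mod E A * ev_arg E A| != 1.
Proof. by rewrite normrM norm_expi norm_ev_mod mulr1 gt_eqF ?ev_mod_gt1. Qed.
Lemma norm_ev_repl : `|(ev_mod E A)^-1 * ev_arg E A| != 1.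
Proof. by rewrite normrM norm_expi normfV norm_ev_mod mulr1 lt_eqF ?ev_modV_lt1. Qed.

Lemma herm_ax : herm a_ x_ = 0.
Proof. exact: eigen_orth attr_eig xvec_eig (norm_neq1 norm_ev_attr (norm_expi _)). Qed.
Lemma herm_ay : herm a_ y_ = 0.
Proof. exact: eigen_orth attr_eig yvec_eig (norm_neq1 norm_ev_attr (norm_expi _)). Qed.
Lemma herm_rx : herm r_ x_ = 0.
Proof. exact: eigen_orth repl_eig xvec_eig (norm_neq1 norm_ev_repl (norm_expi _)). Qed.
Lemma herm_ry : herm r_ y_ = 0.
Proof. exact: eigen_orth repl_eig yvec_eig (norm_neq1 norm_ev_repl (norm_expi _)). Qed.

Lemma herm_xx : herm x_ x_ = 1. Proof. by have [] := xvecP E loxA. Qed.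
Lemma herm_yy : herm y_ y_ = 1. Proof. by have [] := yvecP E loxA. Qed.
Lemma herm_xy : herm x_ y_ = 0. Proof. exact: xyvecP. Qed.

Lemma eigenvalues_eq (v : 'cV[C]_4) (c k : C) : v != 0 ->
  A *m v = c *: v -> A *m v = k *: v -> c = k.
Proof.
move=> v0 -> /eqP; rewrite -subr_eq0 -scalerBl scaler_eq0 (negPf v0) orbF subr_eq0.
by move/eqP.
Qed.

Lemma attr_repl_eig : ev_mod E A * ev_arg E A != (ev_mod E A)^-1 * ev_arg E A.
Proof.
have s0 : ev_arg E A != 0 by rewrite -normr_eq0 norm_expi oner_eq0.
by rewrite (inj_eq (mulIf s0)) gt_eqF // (lt_trans ev_modV_lt1 ev_mod_gt1).
Qed.

Lemma attr_not_repl : ~ proportional r_ a_.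
Proof.
move=> [c c0 e]; have /eqP := attr_repl_eig; apply.
apply: (@eigenvalues_eq a_); [by case: attr_null|exact: attr_eig|].
have h : a_ = c^-1 *: r_ by rewrite e scalerA mulVf ?scale1r.
by rewrite {1}h -scalemxAr repl_eig h scalerA [in RHS]scalerA mulrC.
Qed.

Lemma herm_ra : herm r_ a_ != 0.
Proof.
by apply/eqP => /(null_orth_null attr_null repl_null); exact: attr_not_repl.
Qed.

(** [loxodromic] provides two unnamed fixed points that exhaust the boundary fixed points. The
    attracting and repelling vectors are fixed and not proportional, so they represent one each. *)
Lemma boundary_fixedP w : boundary_fixed A w ->
  proportional w a_ \/ proportional w r_.
Proof.
have [_ [v1 [v2 [f1 f2 _ h]]]] := loxA => fw.
have psym v v' : proportional v v' -> proportional v' v.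
  by move=> [c c0 ->]; exists c^-1; rewrite ?invr_eq0 // scalerA mulVf ?scale1r.
have ptr v v' v'' : proportional v v' -> proportional v' v'' -> proportional v v''.
  by move=> [c c0 ->] [k k0 ->]; exists (c * k); rewrite ?mulf_neq0 ?scalerA.
have fa : boundary_fixed A a_.
  by split; [exact: attr_null|exists (ev_mod E A * ev_arg E A); exact: attr_eig].
have fr : boundary_fixed A r_.
  by split; [exact: repl_null|exists ((ev_mod E A)^-1 * ev_arg E A); exact: repl_eig].
have nar : ~ proportional r_ a_ := attr_not_repl.
have [ha|ha] := h _ fa; have [hr|hr] := h _ fr; have [hw|hw] := h _ fw.
- by case: nar; apply: (ptr _ _ _ hr); exact: psym.
- by case: nar; apply: (ptr _ _ _ hr); exact: psym.
- by left; apply: (ptr _ _ _ hw); exact: psym.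
- by right; apply: (ptr _ _ _ hw); exact: psym.
- by right; apply: (ptr _ _ _ hw); exact: psym.
- by left; apply: (ptr _ _ _ hw); exact: psym.
- by case: nar; apply: (ptr _ _ _ hr); exact: psym.
- by case: nar; apply: (ptr _ _ _ hr); exact: psym.
Qed.

(** Pairing a vanishing combination with [r_], [a_], [x_], [y_] isolates its coefficients in turn.
    Since [x_] and [y_] are orthogonal by choice, coinciding unit-modulus eigenvalues need no
    separate treatment. *)
Lemma eigenframe_unit : frame a_ r_ x_ y_ \in unitmx.
Proof.
apply: unit_of_inj => v; rewrite mul_frame => h.
have aa := proj2 attr_null; have rr := proj2 repl_null.
have [ra xx yy] : [/\ herm r_ a_ != 0, herm x_ x_ = 1 & herm y_ y_ = 1].
  by split; [exact: herm_ra|exact: herm_xx|exact: herm_yy].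
have ar : herm a_ r_ != 0 by rewrite herm_conj conjC_eq0.
have [ax [ay [rx [ry xy]]]] := (herm_ax, (herm_ay, (herm_rx, (herm_ry, herm_xy)))).
have e w : herm (v 0 0 *: a_ + v 1 0 *: r_ + v 2 0 *: x_ + v 3 0 *: y_) w = 0.
  by rewrite h hermOl.
apply: cV4P; rewrite [RHS]mxE.
- have /eqP := e r_; rewrite !hermE rr (herm0_sym rx) (herm0_sym ry) !mulr0 !addr0.
  by rewrite mulf_eq0 (negPf ar) orbF => /eqP.
- have /eqP := e a_; rewrite !hermE aa (herm0_sym ax) (herm0_sym ay) !mulr0 !addr0 add0r.
  by rewrite mulf_eq0 (negPf ra) orbF => /eqP.
- by have := e x_; rewrite !hermE ax rx xx (herm0_sym xy) !mulr0 mulr1 !addr0 !add0r.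
- by have := e y_; rewrite !hermE ay ry xy yy !mulr0 mulr1 !add0r.
Qed.

End EigenData.

(** * Eigenvalues, trace and [sigma] *)

Section Eigenvalues.
Variables (R : realType) (E : eigenframe R).
Local Notation C := (complex R).
Implicit Types (A : SU31 R) (c : C).

Definition eigrow A : 'rV[C]_4 := \row_(k < 4)
  nth 0 [:: ev_mod E A * ev_arg E A; (ev_mod E A)^-1 * ev_arg E A; ev_x E A; ev_y E A] k.

Lemma mulmx_eigenframe A : loxodromic A ->
  A *m frame (attr E A) (repl E A) (xvec E A) (yvec E A) =
  frame (attr E A) (repl E A) (xvec E A) (yvec E A) *m diag_mx (eigrow A).
Proof.
move=> lA; have [ea er] := (attr_eig E lA, repl_eig E lA).
have [ex ey] := (xvec_eig E lA, yvec_eig E lA).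
set F := frame _ _ _ _.
suff h (k : 'I_4) : A *m col k F = eigrow A 0 k *: col k F.
  apply/matrixP => i k; transitivity ((A *m col k F) i 0).
    by rewrite colE mulmxA -colE [RHS]mxE.
  by rewrite h mul_mx_diag !mxE mulrC.
case: k => [[|[|[|[|//]]]] Hk]; rewrite /F /frame mxE /=.
- by rewrite (_ : col _ _ = attr E A) ?ea //; apply/colP => i; rewrite !mxE.
- by rewrite (_ : col _ _ = repl E A) ?er //; apply/colP => i; rewrite !mxE.
- by rewrite (_ : col _ _ = xvec E A) ?ex //; apply/colP => i; rewrite !mxE.
- by rewrite (_ : col _ _ = yvec E A) ?ey //; apply/colP => i; rewrite !mxE.
Qed.

Lemma eigenvalueE A c : loxodromic A ->
  eigenvalue A c = [exists k, c == eigrow A 0 k].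
Proof.
move=> lA; have := mulmx_eigenframe lA; have := eigenframe_unit E lA.
move: (frame _ _ _ _) => F uF AF.
apply/eigenvalueP/existsP => [[v vA v0]|[k /eqP ->]].
  have : v *m F != 0 by apply: contra_neq v0 => vF; rewrite -[v](mulmxK uF) vF mul0mx.
  move/rV0Pn => [k hk]; exists k; apply/eqP/(mulIf hk).
  have := congr1 (mulmx^~ F) vA; rewrite -mulmxA AF mulmxA -scalemxAl.
  by move/(congr1 (fun M : 'rV__ => M 0 k)); rewrite mul_mx_diag !mxE mulrC => ->.
exists (delta_mx 0 k *m invmx F).
  have eA : (A : 'M_4) = F *m diag_mx (eigrow A) *m invmx F by rewrite -AF mulmxK.
  rewrite {1}eA !mulmxA mulmxKV // scalemxAl; congr (_ *m _).
  by rewrite -rowE row_diag_mx.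
apply: contraTneq isT => /(congr1 (mulmx^~ F)); rewrite mulmxKV // mul0mx.
by move/(congr1 (fun M : 'rV__ => M 0 k)); rewrite !mxE !eqxx => /eqP; rewrite oner_eq0.
Qed.

Lemma trace_eig A : loxodromic A -> \tr A = \sum_k eigrow A 0 k.
Proof.
move=> lA; have uF := eigenframe_unit E lA.
by rewrite -[X in \tr X](mulmxK uF) mulmx_eigenframe // mxtrace_mulC mulKmx // mxtrace_diag.
Qed.

Lemma trace_sqr_eig A : loxodromic A ->
  \tr ((A : 'M_4) *m (A : 'M_4)) = \sum_k eigrow A 0 k ^+ 2.
Proof.
move=> lA; have uF := eigenframe_unit E lA.
have AF := mulmx_eigenframe lA.
rewrite -[X in \tr X](mulmxK uF) -[X in X *m invmx _]mulmxA AF mulmxA AF.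
rewrite mxtrace_mulC -[X in _ *m X]mulmxA mulKmx // mulmx_diag mxtrace_diag.
by apply: eq_bigr => k _; rewrite !mxE expr2.
Qed.

(** The product of the [c - eigrow A 0 k] is expanded, conjugates of unit-modulus numbers being
    inverses. Thus the trace and [sigma] fix the set of eigenvalues, which is what [ef_labelling]
    takes as input. *)
Lemma char_poly_eig A c : loxodromic A ->
  eigenvalue A c = (c ^+ 4 - \tr A * c ^+ 3 + ((sigma A)%:C)%C * c ^+ 2
                    - (\tr A)^* * c + 1 == 0).
Proof.
move=> lA.
have r0 := ev_mod_neq0 E lA.
have rc : (ev_mod E A)^* = ev_mod E A := conj_real _.
have [ss uu] := (ev_argJ E A, ev_xJ E A).
have sig : ((sigma A)%:C)%C = 2^-1 * ((\tr A) ^+ 2 - \tr ((A : 'M_4) *m (A : 'M_4))).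
  (* The real part loses nothing: written in the eigenvalues, the number equals its conjugate. *)
  rewrite /sigma RRe_real //; apply/CrealP.
  rewrite trace_eig // trace_sqr_eig // !sum4 !mxE /= ev_yE.
  move: ss uu rc r0; move: (ev_arg _ _) (ev_x _ _) (ev_mod _ _) => s u r ss uu rc r0.
  have s0 : s != 0 by apply: contra_eq_neq ss => ->; rewrite mul0r eq_sym oner_eq0.
  have u0 : u != 0 by apply: contra_eq_neq uu => ->; rewrite mul0r eq_sym oner_eq0.
  have sV : s^* = s^-1 by apply: (mulfI s0); rewrite ss divff.
  have uV : u^* = u^-1 by apply: (mulfI u0); rewrite uu divff.
  rewrite !(cjE, expr2) rc sV uV ?invrK.
  by field; rewrite s0 u0 r0.
have -> : c ^+ 4 - \tr A * c ^+ 3 + ((sigma A)%:C)%C * c ^+ 2 - (\tr A)^* * c + 1 =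
   \prod_k (c - eigrow A 0 k).
  rewrite sig trace_eig // trace_sqr_eig // !sum4.
  rewrite !big_ord_recl big_ord0 !mxE /= ev_yE.
  move: ss uu rc r0; move: (ev_arg _ _) (ev_x _ _) (ev_mod _ _) => s u r ss uu rc r0.
  have s0 : s != 0 by apply: contra_eq_neq ss => ->; rewrite mul0r eq_sym oner_eq0.
  have u0 : u != 0 by apply: contra_eq_neq uu => ->; rewrite mul0r eq_sym oner_eq0.
  have sV : s^* = s^-1 by apply: (mulfI s0); rewrite ss divff.
  have uV : u^* = u^-1 by apply: (mulfI u0); rewrite uu divff.
  rewrite !(cjE, expr2) rc sV uV ?invrK.
  by field; rewrite s0 u0 r0.
rewrite eigenvalueE // prodf_seq_eq0 /=.
apply/existsP/hasP => [[k /eqP ->]|[k _]]; last by rewrite subr_eq0; exists k.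
by exists k; rewrite ?subrr ?mem_index_enum.
Qed.

(** The labelling fixes [ef_phi]. Only the attracting eigenvalue has modulus above 1, so those of
    [A] and [A'] coincide, and taking the modulus separates [ev_mod] from [ev_arg]. *)
Lemma eigen_data_eq A A' : loxodromic A -> loxodromic A' ->
  \tr A = \tr A' -> sigma A = sigma A' ->
  [/\ ev_mod E A = ev_mod E A', ev_arg E A = ev_arg E A', ev_x E A = ev_x E A'
    & ev_y E A = ev_y E A'].
Proof.
move=> lA lA' ht hs.
have he c : eigenvalue A c = eigenvalue A' c by rewrite !char_poly_eig // ht hs.
have hx : ev_x E A = ev_x E A' by rewrite /ev_x (ef_labelling E lA lA' he).
suff [hm ha] : ev_mod E A = ev_mod E A' /\ ev_arg E A = ev_arg E A'.
  by split; rewrite // !ev_yE ha hx.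
have : eigenvalue A' (ev_mod E A * ev_arg E A).
  by rewrite -he eigenvalueE //; apply/existsP; exists 0; rewrite mxE.
have nm := norm_ev_mod E lA; have nm' := norm_ev_mod E lA'.
have g := ev_mod_gt1 E lA; have g' := ev_modV_lt1 E lA'.
have na (B : SU31 R) : `|ev_arg E B| = 1 by exact: norm_expi.
have key : `|ev_mod E A * ev_arg E A| = ev_mod E A by rewrite normrM na nm mulr1.
rewrite eigenvalueE // => /existsP [[[|[|[|[|//]]]] Hk]] /eqP; rewrite mxE /= => h.
- have hm : ev_mod E A = ev_mod E A' by rewrite -key h normrM na nm' mulr1.
  by split=> //; apply: (mulfI (ev_mod_neq0 E lA)); rewrite h hm.
- move: key; rewrite h normrM na normfV nm' mulr1 => e.
  by move: (lt_trans g' g); rewrite e ltxx.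
- by move: key g; rewrite h norm_expi => <-; rewrite ltxx.
- by move: key g; rewrite h norm_expi => <-; rewrite ltxx.
Qed.

End Eigenvalues.

(** * Rigidity *)

Section Quadruples.
Variable R : realType.
Local Notation C := (complex R).
Implicit Types (a r b s v w z : 'cV[C]_4).

Lemma frame_inj a b c d (u : 'cV[C]_4) : frame a b c d \in unitmx ->
  u 0 0 *: a + u 1 0 *: b + u 2 0 *: c + u 3 0 *: d = 0 -> u = 0.
Proof. by move=> F; rewrite -mul_frame => h; rewrite -(mulKmx F u) h mulmx0. Qed.

(* The triple product of the three null vectors is [herm b r]; its real part is
   nonpositive, and vanishes only when they span a complex line. *)
Lemma triple_null a r b : null a -> null r -> null b ->
  herm r a = 1 -> herm b a = 1 ->
  herm b r + (herm b r)^* <= 0 /\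
  (herm b r + (herm b r)^* = 0 -> b = herm b r *: a + r).
Proof.
move=> na nr nb ra ba.
have aa := proj2 na; have rr := proj2 nr; have bb := proj2 nb.
have ar : herm a r = 1 by rewrite herm_conj ra cj1.
have ab : herm a b = 1 by rewrite herm_conj ba cj1.
pose w := b - (herm b r *: a + r).
have wa : herm w a = 0 by rewrite /w !hermE aa ra ba; ring.
have wr : herm w r = 0 by rewrite /w !hermE ar rr; ring.
have ww : herm w w = - (herm b r + (herm b r)^*).
  by rewrite /w !hermE -/w (herm_conj b r) aa rr bb ar ra ab ba; ring.
have [|p q] := hyperbolic_orth na nr _ wa wr; first by rewrite ra oner_eq0.
split; first by rewrite -oppr_ge0 -ww.
by move=> h; apply/eqP; rewrite -subr_eq0; apply/eqP/q; rewrite ww h oppr0.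
Qed.

Definition normal_quad a r b s : Prop :=
  [/\ null a, null r, null b & null s] /\
  [/\ herm r a = 1, herm s b = 1, herm b a = 1 & `|herm b r| = 1].

Lemma nullZ (k : C) v : k != 0 -> null v -> null (k *: v).
Proof.
move=> k0 [v0 vv]; split; first by rewrite scaler_eq0 negb_or k0.
by rewrite !hermE vv !mulr0.
Qed.

Lemma normalize_quad a r b s : null a -> null r -> null b -> null s ->
  herm r a != 0 -> herm s b != 0 -> herm b a != 0 -> herm b r != 0 ->
  exists k1 k2 k3 k4, [/\ k1 != 0, k2 != 0, k3 != 0 & k4 != 0] /\
    normal_quad (k1 *: a) (k2 *: r) (k3 *: b) (k4 *: s).
Proof.
move=> na nr nb ns ra sb ba br.
(* With [k1 = l], the conditions on [<r,a>] and [<b,a>] force [k2] and [k3]. Then [|<b,r>|] gets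
   divided by [l^2 |<b,a>| |<r,a>|], and this [l] makes the quotient 1. *)
pose l := sqrtC (`|herm b r| / (`|herm b a| * `|herm r a|)).
have l0 : 0 < l by rewrite sqrtC_gt0 divr_gt0 ?mulr_gt0 ?normr_gt0.
have ln : l != 0 by rewrite gt_eqF.
have lc : l^* = l by apply/conj_Creal/gtr0_real.
pose k2 := (l * herm r a)^-1; pose k3 := (l * herm b a)^-1.
have k2n : k2 != 0 by rewrite invr_eq0 mulf_neq0.
have k3n : k3 != 0 by rewrite invr_eq0 mulf_neq0.
have k4n : (k3^* * herm s b)^-1 != 0 by rewrite invr_eq0 mulf_neq0 // conjC_eq0.
exists l, k2, k3, (k3^* * herm s b)^-1; split; first by split.
split; first by split; exact: nullZ.
split; rewrite hermZl hermZr ?lc.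
- by rewrite /k2; field; rewrite ra ln.
- by field; rewrite conjC_eq0 k3n sb.
- by rewrite /k3; field; rewrite ba ln.
rewrite !normrM norm_conjC !normfV !normrM (gtr0_norm l0).
have l2 : l * l = `|herm b r| / (`|herm b a| * `|herm r a|) by rewrite -expr2 sqrtCK.
rewrite mulrA -invfM mulrACA l2.
by rewrite divfK ?mulVf ?mulf_neq0 ?normr_eq0.
Qed.

(** With [q = <b,r>], [p = <s,a>], [w = <s,r>] and [|q| = 1], the three cross-ratios are [p / q],
    [w] and [w / (p q)]. They determine [w], [p / q] and [p q], hence [q^2]. *)
Lemma quad_gram a r b s a' r' b' s' :
  normal_quad a r b s -> normal_quad a' r' b' s' ->
  frame a r b s \in unitmx -> herm s a != 0 -> herm s r != 0 ->
  cross b a r s = cross b' a' r' s' -> cross b r a s = cross b' r' a' s' ->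
  cross a r b s = cross a' r' b' s' ->
  [/\ herm b r = herm b' r', herm s a = herm s' a' & herm s r = herm s' r'].
Proof.
move=> [[na nr nb ns] [ra sb ba q1]] [[na' nr' nb' ns'] [ra' sb' ba' q1']] F p0 w0.
have conj1 v w : herm v w = 1 -> herm w v = 1 by move=> h; rewrite herm_conj h cj1.
rewrite /cross ra sb ba ra' sb' ba' !(conj1 _ _ ra, conj1 _ _ ba) !(conj1 _ _ ra', conj1 _ _ ba').
rewrite !(mulr1, mul1r, divr1) (herm_conj b r) (herm_conj b' r').
have [t1 t2] := triple_null na nr nb ra ba.
have [t1' t2'] := triple_null na' nr' nb' ra' ba'.
have qV (q : C) : `|q| = 1 -> q != 0 /\ q^* = q^-1.
  move=> h; have q0 : q != 0 by rewrite -normr_eq0 h oner_eq0.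
  by split=> //; apply: (mulfI q0); rewrite divff // -normCK h expr1n.
(* The degenerate case of [triple_null] would be a linear relation between [a], [r] and [b]. *)
have nF : b <> herm b r *: a + r.
  move=> e; have := @frame_inj a r b s (\col_i [:: herm b r; 1; -1; 0]`_i) F.
  rewrite !mxE /= scale0r addr0 scale1r scaleN1r {2}e subrr => /(_ erefl).
  by move/(congr1 (fun u : 'cV[C]_4 => u 1 0))/eqP; rewrite !mxE /= oner_eq0.
move: q1 q1' t1 t2 t1' t2' nF p0 w0.
move: (herm b r) (herm s a) (herm s r) (herm b' r') (herm s' a') (herm s' r').
move=> q p w q' p' w' /qV[q0 qc] /qV[q0' qc'].
rewrite qc qc' => t1 t2 t1' t2' nF p0 w0 h1 h2 h3.
have pE : p = q / q' * p' by rewrite -[p](mulVKf q0) h1; field; rewrite q0'.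
have p0' : p' != 0 by apply: contra_neq p0 => e; rewrite pE e mulr0.
have pq : p * q = p' * q'.
  by apply/invr_inj/(mulfI w0); rewrite h3 h2.
have : q ^+ 2 == q' ^+ 2.
  apply/eqP/(mulfI p0'); transitivity (p * q * q'); first by rewrite pE; field.
  by rewrite pq; ring.
rewrite eqf_sqr => /orP[/eqP e|/eqP e].
  by split=> //; rewrite pE e divff // mul1r.
(* Here [q = - q']: the two real parts are nonpositive and opposite, so they vanish. *)
case: nF; apply: t2; apply/le_anti; rewrite t1 /=.
by move: t1'; rewrite -[q']opprK -e invrN -opprD oppr_le0.
Qed.
End Quadruples.

(** * Transport of fixed points and eigenvectors *)

Lemma sum3 (V : nmodType) (F : 'I_3 -> V) : \sum_i F i = F 0 + F 1 + F 2.
Proof.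
rewrite !big_ord_recl big_ord0 addr0 !addrA.
by congr (_ + F _ + F _); apply: val_inj.
Qed.

Section Rigidity.
Variables (R : realType) (E : eigenframe R).
Local Notation C := (complex R).
Implicit Types (A B : SU31 R) (a c d v w z : 'cV[C]_4).

Lemma herm_comb3l (c1 c2 c3 : C) v1 v2 v3 w :
  herm (c1 *: v1 + c2 *: v2 + c3 *: v3) w =
  c1 * herm v1 w + c2 * herm v2 w + c3 * herm v3 w.
Proof. by rewrite !hermE. Qed.

Lemma herm_comb3r (c1 c2 c3 : C) v1 v2 v3 w :
  herm w (c1 *: v1 + c2 *: v2 + c3 *: v3) =
  c1^* * herm w v1 + c2^* * herm w v2 + c3^* * herm w v3.
Proof. by rewrite !hermE. Qed.

Lemma eigenframe_orth A w : loxodromic A -> herm w (attr E A) = 0 ->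
  herm w (repl E A) = 0 -> herm w (xvec E A) = 0 -> herm w (yvec E A) = 0 -> w = 0.
Proof. by move=> /(eigenframe_unit E); exact: frame_orth. Qed.

Lemma boundary_fixed_attr A : loxodromic A -> boundary_fixed A (attr E A).
Proof. by move=> lA; split; [exact: attr_null|eexists; exact: attr_eig]. Qed.

Lemma boundary_fixed_repl A : loxodromic A -> boundary_fixed A (repl E A).
Proof. by move=> lA; split; [exact: repl_null|eexists; exact: repl_eig]. Qed.

Lemma chain_of_orth A v : loxodromic A -> v != 0 ->
  herm v (attr E A) = 0 -> herm v (repl E A) = 0 ->
  exists M : 'M[C]_(4, 3), C21_copy M /\ forall w, herm w v = 0 -> exists z : 'cV[C]_3, w = M *m z.
Proof.
move=> lA v0 va vr.
have [na nr] := (attr_null E lA, repl_null E lA).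
have [aa rr] := (proj2 na, proj2 nr).
have ra := herm_ra E lA.
have [ax ay rx ry] := And4 (herm_ax E lA) (herm_ay E lA) (herm_rx E lA) (herm_ry E lA).
have [xx yy xy] := And3 (herm_xx E lA) (herm_yy E lA) (herm_xy E lA).
have w_ext := @eigenframe_orth A ^~ lA.
move: na nr aa rr ra ax ay rx ry xx yy xy va vr w_ext.
move: (attr E A) (repl E A) (xvec E A) (yvec E A) => a r x y.
move=> na nr aa rr ra ax ay rx ry xx yy xy va vr w_ext.
have [xa ya xr yr] := And4 (herm0_sym ax) (herm0_sym ay) (herm0_sym rx) (herm0_sym ry).
have yx := herm0_sym xy.
have [al alE] : exists al, al = herm v x by eexists.
have [be beE] : exists be, be = herm v y by eexists.
have vE : v = al *: x + be *: y.
  apply/eqP; rewrite -subr_eq0; apply/eqP/w_ext; rewrite !hermE.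
  - by rewrite va xa ya; ring.
  - by rewrite vr xr yr; ring.
  - by rewrite xx yx -alE; ring.
  - by rewrite xy yy -beE; ring.
have [N0 N1] := hyperbolic_orth na nr ra va vr.
pose N := herm v v.
have NE : N = al * al^* + be * be^*.
  by rewrite /N {1 2}vE !hermE xx yy xy yx; ring.
have N_neq0 : N != 0 by apply: contra_neq v0; exact: N1.
pose k := sqrtC N; have kk : k ^+ 2 = N by exact: sqrtCK.
have k0 : k != 0 by apply: contra_neq N_neq0 => e; rewrite -kk e expr0n.
have kc : k^* = k by apply/conj_Creal/ger0_real; rewrite sqrtC_ge0.
(* [m0], [m1], [r] form a basis of the complement of [v] with the Gram matrix of [herm21]; [m1] is a
   unit vector orthogonal to [v] in the plane of [x] and [y]. *)
pose m0 := (herm a r)^-1 *: a.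
pose m1 := k^-1 *: (be^* *: x - al^* *: y).
pose M : 'M[C]_(4, 3) := \matrix_(i < 4, j < 3) (nth 0 [:: m0; m1; r] j) i 0.
have ME (u : 'cV[C]_3) : M *m u = u 0 0 *: m0 + u 1 0 *: m1 + u 2 0 *: r.
  apply/colP => i; rewrite !mxE sum3 !mxE /=.
  by ring.
have ar : herm a r != 0 by rewrite herm_conj conjC_eq0.
have ra1 : herm r a = (herm a r)^* by exact: herm_conj.
have m0r : herm m0 r = 1 by rewrite hermZl mulVf.
have m0m0 : herm m0 m0 = 0 by rewrite !hermE aa !mulr0.
have m0m1 : herm m0 m1 = 0 by rewrite !hermE ax ay; ring.
have m1r : herm m1 r = 0 by rewrite !hermE xr yr; ring.
have m1m1 : herm m1 m1 = 1.
  rewrite !hermE xx yy xy yx !cjE kc.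
  transitivity (k^-1 ^+ 2 * (al * al^* + be * be^*)); first by ring.
  by rewrite -NE -kk exprVn mulVf // expf_neq0.
exists M; split => [z w|w wv].
  rewrite !ME /herm21 herm_comb3l !herm_comb3r m0r m0m0 m0m1 m1r m1m1 rr.
  by rewrite (herm_conj m0 r) (herm0_sym m0m1) (herm0_sym m1r) m0r cj1; ring.
(* The null vectors [m0] and [r] are dual to each other, so the coordinate along one is the product
   with the other. *)
pose u : 'cV[C]_3 := \col_i [:: herm w r; herm w m1; herm w m0]`_i.
exists u; apply/eqP; rewrite -subr_eq0; apply/eqP.
pose t := w - M *m u.
have tE : t = w - (herm w r *: m0 + herm w m1 *: m1 + herm w m0 *: r).
  by rewrite /t ME !mxE.
have ta : herm t m0 = 0.
  by rewrite tE hermDl hermNl herm_comb3l m0m0 (herm0_sym m0m1) (herm_conj m0 r) m0r cj1; ring.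
have {}ta : herm t a = 0.
  by move/eqP: ta; rewrite hermZr mulf_eq0 conjC_eq0 invr_eq0 (negPf ar) => /eqP.
have tr : herm t r = 0.
  by rewrite tE hermDl hermNl herm_comb3l m0r m1r rr; ring.
have tm1 : herm t m1 = 0.
  by rewrite tE hermDl hermNl herm_comb3l m0m1 m1m1 (herm0_sym m1r); ring.
have m0v : herm m0 v = 0 by rewrite hermZl (herm0_sym va) mulr0.
have m1v : herm m1 v = 0 by rewrite vE !hermE xx yy xy yx; ring.
have tv : herm t v = 0.
  by rewrite tE hermDl hermNl herm_comb3l wv m0v m1v (herm0_sym vr); ring.
(* Orthogonality of [t] to [m1] and to [v] gives [e1] and [e2], a linear system in [herm t x] and
   [herm t y] with determinant [N]. *)
have e1 : be * herm t x = al * herm t y.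
  move/eqP: tm1; rewrite hermZr mulf_eq0 conjC_eq0 invr_eq0 (negPf k0) /=.
  by rewrite hermDr hermNr !hermZr !cjE subr_eq0 => /eqP.
have e2 : al^* * herm t x + be^* * herm t y = 0 by rewrite -!hermZr -hermDr -vE.
have tx : herm t x = 0.
  apply: (mulfI N_neq0); rewrite mulr0 NE.
  transitivity (al * (al^* * herm t x) + be^* * (be * herm t x)); first by ring.
  by rewrite e1 -[RHS](mulr0 al) -e2; ring.
have ty : herm t y = 0.
  apply: (mulfI N_neq0); rewrite mulr0 NE.
  transitivity (al^* * (al * herm t y) + be * (be^* * herm t y)); first by ring.
  by rewrite -e1 -[RHS](mulr0 be) -e2; ring.
exact: w_ext.
Qed.

Section Pair.
Variables A B : SU31 R.
Hypotheses (lA : loxodromic A) (lB : loxodromic B) (nsAB : non_singular E A B).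

(** Orthogonal null vectors are proportional, which would give a common fixed point. *)
Lemma no_common_fixed v w : boundary_fixed A v -> boundary_fixed B w -> herm v w != 0.
Proof.
move=> [nv [c cv]] [nw [d dw]]; apply/eqP => /(null_orth_null nw nv) [k k0 e].
case: nsAB => h _ _ _; apply: h; exists v; split; [by right|by exists c|exists d].
by rewrite e -scalemxAr dw !scalerA mulrC.
Qed.

Lemma fixed_frame_unit :
  frame (attr E A) (repl E A) (attr E B) (repl E B) \in unitmx.
Proof.
apply: contraT => /singular_orth [v [v0 av rv bv sv]].
have [M [Mc MP]] := chain_of_orth lA v0 (herm0_sym av) (herm0_sym rv).
case: nsAB => _ h _ _; case: h; exists M; split => //.
  move=> w fw; split; first by case: fw.
  by apply: MP; case: (boundary_fixedP E lA fw) => -[k _ ->]; rewrite hermZl ?av ?rv mulr0.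
move=> w fw; split; first by case: fw.
by apply: MP; case: (boundary_fixedP E lB fw) => -[k _ ->]; rewrite hermZl ?bv ?sv mulr0.
Qed.

End Pair.

(** Each vector occupies the same slot of [herm] once above and once below the fraction bar, so its
    factor cancels. Cross-ratios can therefore be computed on normalized lifts. *)
Lemma crossZ k1 k2 k3 k4 (z1 z2 z3 z4 : 'cV[C]_4) :
  k1 != 0 -> k2 != 0 -> k3 != 0 -> k4 != 0 ->
  cross (k1 *: z1) (k2 *: z2) (k3 *: z3) (k4 *: z4) = cross z1 z2 z3 z4.
Proof.
move=> h1 h2 h3 h4; rewrite /cross !hermE.
rewrite [X in X / _](_ : _ = (k3 * k1^* * k4 * k2^*) * (herm z3 z1 * herm z4 z2)); last by ring.
rewrite [X in _ / X](_ : _ = (k3 * k1^* * k4 * k2^*) * (herm z4 z1 * herm z3 z2)); last by ring.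
by rewrite -mulf_div divff ?mul1r // !mulf_neq0 // conjC_eq0.
Qed.

(** Both quadruples are normalized, [quad_gram] equates their Gram matrices and [gram_isometry]
    provides [h]. The final scalars undo the normalizations. *)
Lemma fixed_points_conj A B A' B' :
  loxodromic A -> loxodromic B -> non_singular E A B ->
  loxodromic A' -> loxodromic B' -> non_singular E A' B' ->
  X1 E A B = X1 E A' B' -> X2 E A B = X2 E A' B' -> X3 E A B = X3 E A' B' ->
  exists (h : SU31 R) (k1 k2 k3 k4 : C),
    [/\ k1 != 0, k2 != 0, k3 != 0 & k4 != 0] /\
    [/\ h *m attr E A = k1 *: attr E A', h *m repl E A = k2 *: repl E A',
        h *m attr E B = k3 *: attr E B' & h *m repl E B = k4 *: repl E B'].
Proof.
move=> lA lB ns lA' lB' ns' hX1 hX2 hX3.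
have aux A0 B0 : loxodromic A0 -> loxodromic B0 -> non_singular E A0 B0 ->
    exists k1 k2 k3 k4, [/\ k1 != 0, k2 != 0, k3 != 0 & k4 != 0] /\
    normal_quad (k1 *: attr E A0) (k2 *: repl E A0) (k3 *: attr E B0) (k4 *: repl E B0).
  move=> l0 l1 n0; have nc := no_common_fixed n0.
  have [fa fr] := (boundary_fixed_attr l0, boundary_fixed_repl l0).
  have fb := boundary_fixed_attr l1.
  apply: (normalize_quad (attr_null E l0) (repl_null E l0) (attr_null E l1)
    (repl_null E l1) (herm_ra E l0) (herm_ra E l1)).
    by rewrite herm_conj conjC_eq0; exact: nc _ _ fa fb.
  by rewrite herm_conj conjC_eq0; exact: nc _ _ fr fb.
have [k1 [k2 [k3 [k4 [[k10 k20 k30 k40] nq]]]]] := aux _ _ lA lB ns.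
have [k1' [k2' [k3' [k4' [[k10' k20' k30' k40'] nq']]]]] := aux _ _ lA' lB' ns'.
have F : frame (k1 *: attr E A) (k2 *: repl E A) (k3 *: attr E B) (k4 *: repl E B) \in unitmx.
  apply: unit_of_inj => u; rewrite mul_frame !scalerA => hu.
  pose u' : 'cV[C]_4 := \col_i [:: u 0 0 * k1; u 1 0 * k2; u 2 0 * k3; u 3 0 * k4]`_i.
  have := @frame_inj _ _ _ _ _ u' (fixed_frame_unit lA lB ns).
  rewrite !mxE /= => /(_ hu) u0.
  have e (l : 'I_4) : u' l 0 = 0 by rewrite u0 mxE.
  have := (e 0, e 1, e 2, e 3); rewrite !mxE /= => -[[[]]] /eqP + /eqP + /eqP + /eqP.
  rewrite !mulf_eq0 (negPf k10) (negPf k20) (negPf k30) (negPf k40) !orbF.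
  by move=> /eqP ? /eqP ? /eqP ? /eqP ?; apply: cV4P; rewrite [RHS]mxE.
have sa : herm (k4 *: repl E B) (k1 *: attr E A) != 0.
  rewrite herm_conj conjC_eq0 hermZl hermZr !mulf_neq0 ?conjC_eq0 //.
  by apply: (no_common_fixed ns); [exact: boundary_fixed_attr|exact: boundary_fixed_repl].
have sr : herm (k4 *: repl E B) (k2 *: repl E A) != 0.
  rewrite herm_conj conjC_eq0 hermZl hermZr !mulf_neq0 ?conjC_eq0 //.
  by apply: (no_common_fixed ns); exact: boundary_fixed_repl.
have [|||e1 e2 e3] := quad_gram nq nq' F sa sr; rewrite ?crossZ //.
case: nq => [[na nr nb nsr] [h1 h2 h3 _]]; case: nq' => [[na' nr' nb' nsr'] [h1' h2' h3' _]].
have [h [k [k0 ha hr hb hs]]] : exists (h : SU31 R) (k : C), [/\ k != 0,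
    h *m (k1 *: attr E A) = k *: (k1' *: attr E A'),
    h *m (k2 *: repl E A) = k *: (k2' *: repl E A'),
    h *m (k3 *: attr E B) = k *: (k3' *: attr E B')
    & h *m (k4 *: repl E B) = k *: (k4' *: repl E B')].
  apply: (gram_isometry F _ _ _ _ _ _ e2 e1 e3 _).
  - by rewrite (proj2 na) (proj2 na').
  - by rewrite (proj2 nr) (proj2 nr').
  - by rewrite (proj2 nb) (proj2 nb').
  - by rewrite (proj2 nsr) (proj2 nsr').
  - by rewrite h1 h1'.
  - by rewrite h3 h3'.
  - by rewrite h2 h2'.
have sc (l l' : C) v w : l != 0 -> h *m (l *: v) = k *: (l' *: w) ->
    h *m v = (l^-1 * (k * l')) *: w.
  move=> l0; rewrite -scalemxAr => e.
  by rewrite -!scalerA -e scalerA mulVf // scale1r.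
exists h, (k1^-1 * (k * k1')), (k2^-1 * (k * k2')), (k3^-1 * (k * k3')), (k4^-1 * (k * k4')).
split; first by split; rewrite !mulf_neq0 ?invr_eq0.
by split; exact: sc.
Qed.

(** [h *m A] and [A' *m h] agree on the eigenbasis of [A], the eigenvalues being equal by
    [eigen_data_eq]. *)
Lemma conj_of_eigenframe A A' (h : SU31 R) (k1 k2 k3 k4 : C) :
  loxodromic A -> loxodromic A' -> \tr A = \tr A' -> sigma A = sigma A' ->
  h *m attr E A = k1 *: attr E A' -> h *m repl E A = k2 *: repl E A' ->
  h *m xvec E A = k3 *: xvec E A' -> h *m yvec E A = k4 *: yvec E A' ->
  A' = (h * A * h^-1)%g.
Proof.
move=> lA lA' ht hs ha hr hx hy.
have [em ea ex ey] := eigen_data_eq E lA lA' ht hs.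
suff e : (h : 'M_4) *m A = (A' : 'M_4) *m h.
  have e' : (h * A)%g = (A' * h)%g by apply: val_inj.
  by rewrite e' mulgK.
have F := eigenframe_unit E lA.
have H v : h *m (A *m v) = A' *m (h *m v).
  have [c1 [c2 [c3 [c4 ->]]]] := frame_span v F.
  rewrite !mulmxDr -!scalemxAr (attr_eig E lA) (repl_eig E lA) (xvec_eig E lA) (yvec_eig E lA).
  rewrite -!scalemxAr ha hr hx hy -!scalemxAr.
  rewrite (attr_eig E lA') (repl_eig E lA') (xvec_eig E lA') (yvec_eig E lA').
  rewrite !scalerA em ea ex ey.
  by rewrite (mulrAC c1 _ k1) (mulrAC c2 _ k2) (mulrAC c3 _ k3) (mulrAC c4 _ k4).
apply/matrixP => i j; have := H (delta_mx j 0); rewrite !mulmxA -!colE.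
by move/(congr1 (fun u : 'cV[C]_4 => u i 0)); rewrite !mxE.
Qed.

Definition other (j : 'I_2) : 'I_2 := if j == 0 then 1 else 0.

Lemma pvec_props A j : loxodromic A ->
  [/\ herm (pvec E j A) (attr E A) = 0, herm (pvec E j A) (repl E A) = 0,
      herm (pvec E j A) (pvec E j A) = 1, herm (pvec E j A) (pvec E (other j) A) = 0
    & pvec E j A != 0].
Proof.
move=> lA; have [ax ay rx ry] := And4 (herm_ax E lA) (herm_ay E lA) (herm_rx E lA) (herm_ry E lA).
have [xx yy xy] := And3 (herm_xx E lA) (herm_yy E lA) (herm_xy E lA).
rewrite /pvec /other; case: (j == 0) => /=.
  split; rewrite ?(herm0_sym ax) ?(herm0_sym rx) //.
  by apply: contra_eq_neq xx => ->; rewrite hermOl eq_sym oner_eq0.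
split; rewrite ?(herm0_sym ay) ?(herm0_sym ry) //; first exact: herm0_sym.
by apply: contra_eq_neq yy => ->; rewrite hermOl eq_sym oner_eq0.
Qed.

Lemma pvec_orth A j w : loxodromic A -> herm w (attr E A) = 0 ->
  herm w (repl E A) = 0 -> herm w (pvec E j A) = 0 ->
  herm w (pvec E (other j) A) = 0 -> w = 0.
Proof.
rewrite /pvec /other => lA wa wr; case: (j == 0) => /= w1 w2.
  exact: (@eigenframe_orth A).
exact: (@eigenframe_orth A).
Qed.

(* The ratio of [herm p s] to [herm p b] recovers [p] up to a scalar, because
   [a], [r], [b], [s] form a basis and [p] is orthogonal to [a] and [r]. *)
Lemma axis_conj A B A' B' (h : SU31 R) (k1 k2 k3 k4 : C) (j : 'I_2) :
  loxodromic A -> loxodromic B -> loxodromic A' -> loxodromic B' ->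
  frame (attr E A') (repl E A') (attr E B') (repl E B') \in unitmx ->
  \tr A = \tr A' -> sigma A = sigma A' ->
  k1 != 0 -> k2 != 0 -> k3 != 0 -> k4 != 0 ->
  h *m attr E A = k1 *: attr E A' -> h *m repl E A = k2 *: repl E A' ->
  h *m attr E B = k3 *: attr E B' -> h *m repl E B = k4 *: repl E B' ->
  cross_defined (repl E B) (attr E B) (pvec E j A) (attr E A) ->
  cross_defined (repl E B') (attr E B') (pvec E j A') (attr E A') ->
  cross (repl E B) (attr E B) (pvec E j A) (attr E A) != 0 ->
  cross (repl E B) (attr E B) (pvec E j A) (attr E A) =
  cross (repl E B') (attr E B') (pvec E j A') (attr E A') ->
  A' = (h * A * h^-1)%g.
Proof.
move=> lA lB lA' lB' F ht hs k10 k20 k30 k40 ha hr hb hs' d d' n0 eb.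
have n0' : cross (repl E B') (attr E B') (pvec E j A') (attr E A') != 0 by rewrite -eb.
have tr0 (k : C) v w : k != 0 -> herm v w = 0 ->
    forall w', h *m w = k *: w' -> herm (h *m v) w' = 0.
  move=> k0 vw w' hw; have /eqP := SU31_herm h v w; rewrite hw hermZr vw.
  by rewrite mulf_eq0 conjC_eq0 (negPf k0) => /eqP.
have [pa pr pp pq p0] := pvec_props j lA.
have [pa' pr' pp' pq' p0'] := pvec_props j lA'.
pose p := pvec E j A; pose p' := pvec E j A'.
have [k5 k50 hp] : exists2 k5 : C, k5 != 0 & h *m p = k5 *: p'.
  have hpa := tr0 _ _ _ k10 pa _ ha; have hpr := tr0 _ _ _ k20 pr _ hr.
  move: d d'; rewrite /cross_defined !mulf_eq0 !negb_or -/p -/p' => /andP[as0 pb0] /andP[as0' pb0'].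
  have hab : herm (attr E A) (attr E B) = k1 * k3^* * herm (attr E A') (attr E B').
    by rewrite -(SU31_herm h) ha hb hermZl hermZr mulrA.
  have has : herm (attr E A) (repl E B) = k1 * k4^* * herm (attr E A') (repl E B').
    by rewrite -(SU31_herm h) ha hs' hermZl hermZr mulrA.
  have hpb : herm p (attr E B) = k3^* * herm (h *m p) (attr E B').
    by rewrite -(SU31_herm h) hb hermZr.
  have hps : herm p (repl E B) = k4^* * herm (h *m p) (repl E B').
    by rewrite -(SU31_herm h) hs' hermZr.
  have hpb0 : herm (h *m p) (attr E B') != 0.
    by move: pb0; rewrite hpb mulf_eq0 negb_or => /andP[].
  (* Every product in the first cross-ratio is expressed in the second configuration; the factors
     coming from [k1], [k3], [k4] cancel in [eb]. *)
  have ratio : herm (h *m p) (repl E B') * herm p' (attr E B') =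
               herm p' (repl E B') * herm (h *m p) (attr E B').
    have ab0' : herm (attr E A') (attr E B') != 0.
      by move: n0'; rewrite /cross !mulf_eq0 !negb_or => /andP[/andP[]].
    move/eqP: eb; rewrite /cross eqr_div ?mulf_neq0 // -/p -/p' hab has hpb hps => /eqP.
    move: k10 k30 k40 as0' ab0'; rewrite -(conjC_eq0 k3) -(conjC_eq0 k4).
    move: (k3^*) (k4^*) => c3 c4 k10 c30 c40 as0' ab0' e.
    have nz : k1 * c3 * c4 * herm (attr E A') (repl E B') * herm (attr E A') (attr E B') != 0.
      by rewrite !mulf_neq0.
    apply: (mulfI nz).
    transitivity (c4 * herm (h *m p) (repl E B') * (k1 * c3 * herm (attr E A') (attr E B')) *
      (herm (attr E A') (repl E B') * herm p' (attr E B'))); first by ring.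
    by rewrite e; ring.
  exists (herm (h *m p) (attr E B') / herm p' (attr E B')).
    by rewrite mulf_neq0 ?invr_eq0.
  (* Both terms are orthogonal to the first two frame vectors; the coefficients give orthogonality
     to the third, and [ratio] to the fourth. *)
  have w0 : herm p' (attr E B') *: (h *m p) - herm (h *m p) (attr E B') *: p' = 0.
    apply: (frame_orth F); rewrite !(hermDl, hermNl, hermZl).
    - by rewrite hpa pa'; ring.
    - by rewrite hpr pr'; ring.
    - by ring.
    - by rewrite mulrC ratio; ring.
  apply: (scalerI pb0'); move/subr0_eq: w0 => ->.
  by rewrite scalerA mulrCA mulfV // mulr1.
have [qa qr qq qp _] := pvec_props (other j) lA.
have [qa' qr' qq' qp' _] := pvec_props (other j) lA'.
pose q := pvec E (other j) A; pose q' := pvec E (other j) A'.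
(* [h *m q] is orthogonal to the attracting and repelling vectors of [A'] and to [p'], so only its
   component along [q'] remains. *)
have hq : h *m q = herm (h *m q) q' *: q'.
  apply/eqP; rewrite -subr_eq0; apply/eqP; apply: (pvec_orth (j := j) lA').
  - by rewrite !(hermDl, hermNl, hermZl) qa' (tr0 _ _ _ k10 qa _ ha); ring.
  - by rewrite !(hermDl, hermNl, hermZl) qr' (tr0 _ _ _ k20 qr _ hr); ring.
  - rewrite !(hermDl, hermNl, hermZl) (herm0_sym pq') (tr0 _ _ _ k50 (herm0_sym pq) _ hp).
    by ring.
  - by rewrite !(hermDl, hermNl, hermZl) -/q' qq'; ring.
case: (j =P 0) => j0.
  apply: (conj_of_eigenframe (k3 := k5) (k4 := herm (h *m q) q') lA lA' ht hs ha hr).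
    by move: hp; rewrite /p /p' /pvec j0.
  by move: hq; rewrite /q /q' /pvec /other j0.
apply: (conj_of_eigenframe (k4 := k5) (k3 := herm (h *m q) q') lA lA' ht hs ha hr).
  by move: hq; rewrite /q /q' /pvec /other; move/eqP/negPf: j0 => ->.
by move: hp; rewrite /p /p' /pvec; move/eqP/negPf: j0 => ->.
Qed.

Lemma non_singular_sym A B : non_singular E A B -> non_singular E B A.
Proof.
move=> [h1 h2 h3 h4]; split=> // -[x [y z t]]; first by apply: h1; exists x.
by apply: h2; exists x.
Qed.

End Rigidity.

(** * From pairs of matrices to representations *)

Section Representations.
Variables (R : realType) (F : groupType).
Implicit Types (rho : {multiplicative F -> SU31 R}) (g : SU31 R).

Definition conj_rep g rho (w : F) : SU31 R := (g * rho w * g^-1)%g.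

Lemma conj_rep_mul g rho : {morph conj_rep g rho : x y / (x * y)%g >-> (x * y)%g}.
Proof. by move=> x y; rewrite /conj_rep gmulfM !mulgA mulgVK. Qed.

HB.instance Definition _ g rho :=
  isMultiplicative.Build F (SU31 R) (conj_rep g rho) (@conj_rep_mul g rho).

(** The conjugate of [rho] by [g] is a homomorphism with the values of [rho'] on the basis, so
    uniqueness in the universal property identifies the two. *)
Lemma conjugate_on_basis (m n : F) rho rho' g : free_basis2 m n ->
  rho' m = (g * rho m * g^-1)%g -> rho' n = (g * rho n * g^-1)%g ->
  conjugate rho rho'.
Proof.
move=> hF hm hn; exists g => w.
have [f [_ _ fU]] := hF _ (rho' m) (rho' n).
by rewrite (fU rho' erefl erefl) -(fU (conj_rep g rho)) // /conj_rep ?hm ?hn.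
Qed.

End Representations.

Section RigidityOfPairs.
Variables (R : realType) (E : eigenframe R).
Implicit Types A B : SU31 R.

Lemma pair_conj i j A B A' B' :
  loxodromic A -> loxodromic B -> non_singular E A B ->
  loxodromic A' -> loxodromic B' -> non_singular E A' B' ->
  alpha_defined E i A B -> alpha E i A B != 0 -> alpha_defined E i A' B' ->
  beta_defined E j A B -> beta E j A B != 0 -> beta_defined E j A' B' ->
  parameters_of E i j A B = parameters_of E i j A' B' ->
  exists g : SU31 R, A' = (g * A * g^-1)%g /\ B' = (g * B * g^-1)%g.
Proof.
move=> lA lB ns lA' lB' ns' da na da' db nb db' [tA tB sA sB x1 x2 x3 ea eb].
have [h [k1 [k2 [k3 [k4 [[k10 k20 k30 k40] [ha hr hb hs]]]]]]] :=
  fixed_points_conj lA lB ns lA' lB' ns' x1 x2 x3.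
exists h; split.
  exact: (axis_conj lA lB lA' lB' (fixed_frame_unit lA' lB' ns') tA sA
    k10 k20 k30 k40 ha hr hb hs db db' nb eb).
(* [alpha] of a pair is [beta] of the reversed pair, so the same [h] serves with the roles
   exchanged. *)
exact: (axis_conj lB lA lB' lA' (fixed_frame_unit lB' lA' (non_singular_sym ns'))
  tB sB k30 k40 k10 k20 hb hs ha hr da da' na ea).
Qed.

(** Four products must be nonzero: the two with the axis because its polar chain misses the fixed
    points of [A], the two with [attr E B] because there is no common fixed point. *)
Lemma exists_pvec A B : loxodromic A -> loxodromic B -> non_singular E A B ->
  exists i, alpha_defined E i A B /\ alpha E i A B != 0.
Proof.
move=> lA lB ns.
have fa := boundary_fixed_attr E lA; have fr := boundary_fixed_repl E lA.
have fb := boundary_fixed_attr E lB.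
suff [i [ia ir]] : exists i, herm (pvec E i B) (attr E A) != 0 /\ herm (pvec E i B) (repl E A) != 0.
  have ba : herm (attr E B) (attr E A) != 0.
    by rewrite herm_conj conjC_eq0; exact: no_common_fixed ns _ _ fa fb.
  have br : herm (attr E B) (repl E A) != 0.
    by rewrite herm_conj conjC_eq0; exact: no_common_fixed ns _ _ fr fb.
  by exists i; rewrite /alpha_defined /alpha /cross_defined /cross !mulf_neq0 ?invr_eq0 ?mulf_neq0.
have aux (p v : 'cV_4) : boundary_fixed A `&` polar_chain p = set0 ->
    boundary_fixed A v -> herm p v != 0.
  move=> h fv; apply/eqP => /herm0_sym pv.
  have : (boundary_fixed A `&` polar_chain p) v by split=> //; split=> //; case: fv.
  by rewrite h.
case: ns => _ _ [h|h] _; [exists 0|exists 1]; rewrite /pvec /=; split; exact: (aux _ _ h).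
Qed.

Lemma X_defined_of_non_singular A B : loxodromic A -> loxodromic B ->
  non_singular E A B -> X_defined E A B.
Proof.
move=> lA lB ns.
have fa := boundary_fixed_attr E lA; have fr := boundary_fixed_repl E lA.
have fb := boundary_fixed_attr E lB; have fs := boundary_fixed_repl E lB.
have ra := herm_ra E lA; have sb := herm_ra E lB.
have ar : herm (attr E A) (repl E A) != 0 by rewrite herm_conj conjC_eq0.
have nc := no_common_fixed ns.
split; apply: mulf_neq0 => //.
  by rewrite herm_conj conjC_eq0; exact: nc.
by rewrite herm_conj conjC_eq0; exact: nc.
Qed.

Lemma rigidity (F2 : groupType) (m n : F2) (rho : {multiplicative F2 -> SU31 R}) :
  free_basis2 m n -> loxodromic (rho m) -> loxodromic (rho n) ->
  non_singular E (rho m) (rho n) ->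
  exists i j : 'I_2,
   [/\ R_lox E m n i j rho,
       parameter_space E (parameters_of E i j (rho m) (rho n))
     & forall rho' : {multiplicative F2 -> SU31 R}, R_lox E m n i j rho' ->
         parameters_of E i j (rho' m) (rho' n) = parameters_of E i j (rho m) (rho n) ->
         conjugate rho rho'].
Proof.
move=> hF lA lB ns.
have [i [da na]] := exists_pvec lA lB ns.
have [j [db nb]] := exists_pvec lB lA (non_singular_sym ns).
exists i, j; split=> //.
  split=> //=; exists (rho m), (rho n); split=> //.
  exact: X_defined_of_non_singular.
move=> rho' [lA' lB' ns' [da' _] [db' _]] e.
have [g [gm gn]] := pair_conj lA lB ns lA' lB' ns' da na da' db nb db' (esym e).
exact: conjugate_on_basis hF gm gn.
Qed.

End RigidityOfPairs.

(** * Dimension of the parameter space *)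

Section PointwiseDerivative.
Variables (R : realType) (V : normedModType R).
Implicit Types (f g : V -> R) (x v : V).

Lemma is_derive_add f g x v (df dg : R) : is_derive x v f df -> is_derive x v g dg ->
  is_derive x v (fun y => f y + g y) (df + dg).
Proof. by move=> hf hg; exact: is_deriveD. Qed.

Lemma is_derive_mul f g x v (df dg : R) : is_derive x v f df -> is_derive x v g dg ->
  is_derive x v (fun y => f y * g y) (f x * dg + g x * df).
Proof. by move=> hf hg; exact: is_deriveM. Qed.

Lemma is_derive_opp f x v (df : R) : is_derive x v f df ->
  is_derive x v (fun y => - f y) (- df).
Proof. by move=> hf; exact: is_deriveN. Qed.

End PointwiseDerivative.

(** * Upper bound on the dimension *)

Section Upper.
Variable R : realType.

(** The Jacobian is square, hence invertible; the preimage of a basis vector is a direction that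
    moves a single coordinate to first order. *)
Lemma row_free_directional N (f : 'rV[R]_N -> 'rV[R]_N) (x : 'rV[R]_N) (k : 'I_N) :
  differentiable f x -> row_free (jacobian f x) ->
  exists v : 'rV[R]_N, forall l, is_derive x v (fun y => f y 0 l) (l == k)%:R.
Proof.
move=> df; rewrite row_free_unit => uJ.
pose v : 'rV[R]_N := delta_mx 0 k *m invmx (jacobian f x).
have dv : derivable f x v by exact: diff_derivable.
exists v => l; apply: DeriveDef; first by have /derivable_mxP := dv.
have := derive_mx dv; rewrite deriveEjacobian // mulmxKV //.
by move/(congr1 (fun M : 'rV__ => M 0 l)); rewrite !mxE.
Qed.

(* Along a direction moving only Re X2, the derivative of |X1 X3|^2 - |X2|^2 is
   -2 Re X2; hence Re X2 vanishes identically, which is absurd. *)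
Lemma cross_ratio_relation_bound (U : set 'rV[R]_16) (f : 'rV[R]_16 -> 'rV[R]_16) :
  U !=set0 -> C1_immersion U f ->
  ~ (forall x, U x -> (f x 0 6 * f x 0 6 + f x 0 7 * f x 0 7) *
                     (f x 0 10 * f x 0 10 + f x 0 11 * f x 0 11)
                     = f x 0 8 * f x 0 8 + f x 0 9 * f x 0 9).
Proof.
move=> [x0 Ux0] [oU dU _ fU] rel.
(* Entries 6 to 11 of [real_coordinates] are the real and imaginary parts of [X1], [X2], [X3], so
   entry 8 is the real part of [X2]. *)
have dir x : U x -> exists v : 'rV[R]_16,
    forall l, is_derive x v (fun y => f y 0 l) (l == 8)%:R.
  by move=> Ux; apply: row_free_directional; [apply: dU|apply: fU]; rewrite inE.
have near_zero (g : 'rV[R]_16 -> R) x v d : U x -> (forall y, U y -> g y = 0) ->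
    is_derive x v g d -> d = 0.
  move=> Ux g0 dg; have e : \forall y \near x, g y = cst 0 y.
    by near=> y; apply: g0; near: y; apply: open_nbhs_nbhs.
  have := near_eq_derive v e; rewrite derive_cst => <-.
  by rewrite derive_val.
have X2_0 x : U x -> f x 0 8 = 0.
  move=> Ux; have [v dv] := dir x Ux.
  pose c (k : 'I_16) y : R := f y 0 k.
  have d k : (k == 8) = false -> is_derive x v (c k) 0.
    by move=> k8; have := dv k; rewrite k8.
  have d8 : is_derive x v (c 8) 1 by have := dv 8; rewrite eqxx.
  have sq k e : is_derive x v (c k) e -> is_derive x v (fun y => c k y * c k y) (2 * c k x * e).
    by move=> h; apply: is_derive_eq (is_derive_mul h h) _; ring.
  pose g y := (c 6 y * c 6 y + c 7 y * c 7 y) * (c 10 y * c 10 y + c 11 y * c 11 y) +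
    - (c 8 y * c 8 y + c 9 y * c 9 y).
  have dg : is_derive x v g (- (2 * f x 0 8)).
    have h := is_derive_add (is_derive_mul
      (is_derive_add (sq _ _ (d 6 erefl)) (sq _ _ (d 7 erefl)))
      (is_derive_add (sq _ _ (d 10 erefl)) (sq _ _ (d 11 erefl))))
      (is_derive_opp (is_derive_add (sq 8 _ d8) (sq _ _ (d 9 erefl)))).
    apply: (is_derive_eq h).
    by rewrite /c; ring.
  suff /eqP : - (2 * f x 0 8) = 0 by rewrite oppr_eq0 mulf_eq0 pnatr_eq0 => /eqP.
  apply: (near_zero g _ _ _ Ux _ dg) => y Uy.
  by rewrite /g; rewrite /c rel // subrr.
(* Entry 8 is now zero on [U], yet its derivative along [v] is 1. *)
have [v dv] := dir _ Ux0.
have := near_zero _ _ _ _ Ux0 X2_0 (dv 8).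
by rewrite eqxx => /eqP; rewrite oner_eq0.
Unshelve. all: by end_near.
Qed.

(** In moduli, [|<b,r>| |<s,a>|] stands above the bar in [X1] and below it in [X3], and cancelling
    it leaves [X2]. Squared moduli keep the relation polynomial in the real coordinates. *)
Lemma cross_ratio_relation (E : eigenframe R) (A B : SU31 R) : X_defined E A B ->
  (X1 E A B * (X1 E A B)^*) * (X3 E A B * (X3 E A B)^*) = X2 E A B * (X2 E A B)^*.
Proof.
rewrite /X_defined /cross_defined /X1 /X2 /X3 /cross.
rewrite (herm_conj (repl E A) (attr E A)) (herm_conj (attr E B) (repl E A)).
rewrite (herm_conj (attr E B) (attr E A)) !mulf_eq0 !negb_or !conjC_eq0.
move: (herm (repl E B) (attr E B)) (herm (repl E A) (attr E A)) => sb ra.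
move: (herm (attr E B) (repl E A)) (herm (repl E B) (attr E A)) => br sa.
move: (herm (attr E B) (attr E A)) (herm (repl E B) (repl E A)) => ba sr.
move=> [/andP[h1 h2] _ /andP[h3 h4]]; rewrite !cjE; field.
by rewrite !conjC_eq0 h1 h2 h3 h4.
Qed.

Lemma mul_conj_coord (c : complex R) : c * c^* =
  ((complex.Re c * complex.Re c + complex.Im c * complex.Im c)%:C)%C.
Proof. by rewrite -normCK -add_Re2_Im2 !expr2. Qed.

Lemma dimension_upper (E : eigenframe R) e :
  contains_submanifold (@real_coordinates R @` parameter_space E) e -> (e <= 15)%N.
Proof.
move=> [U [f [U0 If fU]]]; have [x Ux] := U0.
have [_ _ _ rf] := If.
have : (e <= 16)%N.
  have /eqP <- : row_free (jacobian f x) by apply: rf; rewrite inE.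
  exact: rank_leq_col.
rewrite leq_eqVlt => /orP[/eqP e16|]; last by rewrite ltnS.
subst e; case: (cross_ratio_relation_bound U0 If) => y Uy.
have [p [[A [B [lA lB dX pX]]] _ _] <-] : (@real_coordinates R @` parameter_space E) (f y).
  by apply: fU; exists y.
have := cross_ratio_relation dX; rewrite !mul_conj_coord -rmorphM => /complexI.
by rewrite !mxE /= pX /=.
Qed.

End Upper.

(** * Loxodromic elements with prescribed fixed points *)

Section Dilation.
Variable R : realType.
Local Notation C := (complex R).
Implicit Types (a r v w z : 'cV[C]_4).

Definition herm_row w : 'rV[C]_4 :=
  \row_(k < 4) [:: (w 3 0)^*; (w 1 0)^*; (w 2 0)^*; (w 0 0)^*]`_k.

Lemma herm_rowE w v : herm_row w *m v = (herm v w)%:M.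
Proof.
apply/matrixP => i j; rewrite !ord1 !mxE sum4 !mxE /= /herm.
by ring.
Qed.

(* For null [a], [r] with [herm a r = 1] this doubles [a], halves [r] and fixes
   the orthogonal complement of their span. *)
Definition dilation a r : 'M[C]_4 :=
  1%:M + a *m herm_row r - 2^-1 *: (r *m herm_row a).

Lemma dilationE a r v :
  dilation a r *m v = v + herm v r *: a - (2^-1 * herm v a) *: r.
Proof.
rewrite /dilation mulmxBl mulmxDl mul1mx -scalemxAl -!mulmxA !herm_rowE.
by rewrite !mul_mx_scalar scalerA.
Qed.

Variables (a r : 'cV[C]_4).
Hypotheses (na : null a) (nr : null r) (ar : herm a r = 1).

Let ra : herm r a = 1. Proof. by rewrite herm_conj ar cj1. Qed.

Lemma dilation_herm z w : herm (dilation a r *m z) (dilation a r *m w) = herm z w.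
Proof.
rewrite !dilationE !(hermDl, hermDr, hermNl, hermNr, hermZl, hermZr).
rewrite (proj2 na) (proj2 nr) ar ra (herm_conj w r) (herm_conj w a).
move: (herm z r) (herm z a) (herm w r) (herm w a) (herm z w) => x y x' y' u.
by rewrite !cjE; field.
Qed.

(** Pairing the eigenvalue equation with [r] and [a] gives [2 <v,r> = c <v,r>] and
    [<v,a> / 2 = c <v,a>]. A nonzero product fixes [c] and puts [v] on one of the two lines; if both
    vanish, [v] lies in the positive definite complement. *)
Lemma dilation_eigen v (c : C) : v != 0 -> dilation a r *m v = c *: v ->
  [\/ c = 2 /\ proportional v a, c = 2^-1 /\ proportional v r | 0 < herm v v].
Proof.
move=> v0; rewrite dilationE => h.
have hr : 2 * herm v r = c * herm v r.
  have := congr1 (fun w => herm w r) h.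
  by rewrite /= !(hermDl, hermNl, hermZl) ar (proj2 nr) => <-; ring.
have ha : 2^-1 * herm v a = c * herm v a.
  have := congr1 (fun w => herm w a) h.
  by rewrite /= !(hermDl, hermNl, hermZl) ra (proj2 na) => <-; field.
have ne : (2 : C) != 2^-1.
  by rewrite gt_eqF // (lt_trans (_ : _ < 1)) ?invf_lt1 ?ltr1n.
have [r0|r0] := eqVneq (herm v r) 0; last first.
  have c2 : c = 2 by apply: (mulIf r0).
  have a0 : herm v a = 0.
    apply/eqP/negPn/negP => a0; have e := mulIf a0 ha.
    by move: ne; rewrite e c2 eqxx.
  apply: Or31; split=> //; exists (herm v r) => //.
  move: h; rewrite a0 mulr0 scale0r subr0 c2 scaler_nat mulr2n.
  by move/addrI.
have [a0|a0] := eqVneq (herm v a) 0; last first.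
  have c2 : c = 2^-1 by rewrite (mulIf a0 ha).
  apply: Or32; split=> //; exists (herm v a) => //.
  move: h; rewrite r0 scale0r addr0 c2 -scalerA => h.
  have half : (2^-1 : C) != 0 by rewrite invr_eq0 pnatr_eq0.
  apply: (scalerI half); rewrite -[RHS](subKr v) h -{2}[v]scale1r -scalerBl.
  by congr (_ *: _); field.
apply: Or33; have [|p q] := hyperbolic_orth na nr _ a0 r0; first by rewrite ra oner_eq0.
by rewrite lt0r p andbT; apply: contra_neq v0; exact: q.
Qed.

(** The dilation is moved into SU(3,1) by a unit scalar [k]. Its null eigenvectors have eigenvalues
    of modulus 2 and 1/2, so for every eigenframe the attracting one is on the line of [a] and the
    repelling one on that of [r]. *)
Lemma exists_loxodromic (E : eigenframe R) :
  exists A : SU31 R, [/\ loxodromic A, proportional (attr E A) a & proportional (repl E A) r].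
Proof.
have [A [k [nk kE]]] := isometry_SU31 dilation_herm.
have k0 : k != 0 by rewrite -normr_eq0 nk oner_eq0.
have eig v (c : C) : v != 0 -> A *m v = c *: v ->
    [\/ c = k * 2 /\ proportional v a, c = k * 2^-1 /\ proportional v r | 0 < herm v v].
  move=> v0; rewrite kE => h.
  have {}h : dilation a r *m v = (k^-1 * c) *: v.
    by rewrite -scalerA -h scalerA mulVf // scale1r.
  have cE : c = k * (k^-1 * c) by rewrite mulVKf.
  by case: (dilation_eigen v0 h) => [[e ?]|[e ?]|?]; [apply: Or31|apply: Or32|apply: Or33];
    rewrite // cE e.
have fa : A *m a = (k * 2) *: a.
  by rewrite kE dilationE ar (proj2 na) mulr0 scale0r subr0 scale1r -scalerA scaler_nat mulr2n.
have fr : A *m r = (k * 2^-1) *: r.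
  rewrite kE dilationE ra (proj2 nr) mulr1 scale0r addr0 -scalerA; congr (_ *: _).
  by rewrite -{1}[r]scale1r -scalerBl; congr (_ *: _); field.
have lA : loxodromic A.
  split.
    move=> v nv [c cv]; have v0 : v != 0.
      by apply: contraTneq nv => ->; rewrite /negative hermOl ltxx.
    case: (eig _ _ v0 cv) => [[_ [d _ e]]|[_ [d _ e]]|p].
    - by move: nv; rewrite /negative e !hermE (proj2 na) !mulr0 ltxx.
    - by move: nv; rewrite /negative e !hermE (proj2 nr) !mulr0 ltxx.
    - by move: (lt_trans p nv); rewrite ltxx.
  exists a, r; split.
  - by split=> //; exists (k * 2).
  - by split=> //; exists (k * 2^-1).
  - move=> [d d0 e]; have := oner_neq0 C; rewrite -ar e hermZl (proj2 nr) mulr0 eqxx.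
    by [].
  - move=> w [[w0 ww] [c cw]].
    by case: (eig _ _ w0 cw) => [[_ ?]|[_ ?]|]; [left|right|rewrite ww ltxx].
have n2 : `|2 : C| = 2 by rewrite ger0_norm.
have [m1 mV1] := (ev_mod_gt1 E lA, ev_modV_lt1 E lA).
have nm := norm_ev_mod E lA.
have half : (2^-1 : C) < 1 by rewrite invf_lt1 // ltr1n.
exists A; split=> //.
  have [[v0 vv] ev] := (attr_null E lA, attr_eig E lA).
  case: (eig _ _ v0 ev) => [[_ //]|[/(congr1 Num.norm) e _]|]; last by rewrite vv ltxx.
  move: e m1; rewrite !normrM norm_expi nm nk mul1r mulr1 normfV n2 => -> h.
  by move: (lt_trans h half); rewrite ltxx.
have [[v0 vv] ev] := (repl_null E lA, repl_eig E lA).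
case: (eig _ _ v0 ev) => [[/(congr1 Num.norm) e _]|[_ //]|]; last by rewrite vv ltxx.
move: e mV1; rewrite !normrM norm_expi !normfV nm nk mul1r mulr1 n2 => -> h.
by move: h; rewrite ltrn1.
Qed.

End Dilation.

(** * Realization of cross-ratios by null vectors *)

Section Realization.
Variables (R : realType) (E : eigenframe R).
Local Notation C := (complex R).

(* The fixed points are [a = e1], [r = e4], [b = (q, 1, 0, 1)] and
   [s = (w, v2, v3, -2P)] with [q = - om / 2]; the last hypothesis says that
   [v3] can be chosen so that [s] is null. *)
Lemma realize_cross_ratios (P z om w v2 : C) : P != 0 -> om + om^* = 2 ->
  w = z * P * om -> v2 = 1 - w - P * om^* ->
  0 < 2 * (w * P^* + P * w^*) - v2 * v2^* ->
  cross_ratio_variety E (P * om^*, w, z).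
Proof.
move=> P0 om2 wE v2E.
set h := (X in 0 < X); move=> h0.
have om0 : om != 0.
  apply: contra_eq_neq om2 => ->; by rewrite cj0 addr0 eq_sym pnatr_eq0.
pose v3 := sqrtC h; have v3J : v3 * v3^* = h.
  by rewrite (_ : v3^* = v3) -?expr2 ?sqrtCK //; apply/conj_Creal/ger0_real; rewrite sqrtC_ge0 ltW.
pose a : 'cV[C]_4 := \col_i [:: 1; 0; 0; 0]`_i.
pose r : 'cV[C]_4 := \col_i [:: 0; 0; 0; 1]`_i.
(* The condition on [om] makes [b] null. The outer entries of [s] are [<s,r> = w] and [<s,a> = -2P],
   and the value of [v2] gives [<s,b> = 1]. *)
pose b : 'cV[C]_4 := \col_i [:: - (om / 2); 1; 0; 1]`_i.
pose s : 'cV[C]_4 := \col_i [:: w; v2; v3; - (2 * P)]`_i.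
have c2 : (2 : C)^* = 2 by exact: conjC_nat.
have c1 : (1 : C)^* = 1 by exact: conjC1.
have c0 : (0 : C)^* = 0 by exact: conjC0.
have qc : (- (om / 2))^* = - (om^* / 2) by rewrite cjN cjM cjV c2.
have pc : (- (2 * P))^* = - (2 * P^*) by rewrite cjN cjM c2.
have e0 : [/\ herm a a = 0, herm r r = 0, herm b b = 0 & herm s s = 0].
  rewrite /herm !mxE /= qc pc !(c1, c0); split; [by ring|by ring| |].
    have -> : om^* = 2 - om by rewrite -om2; ring.
    by field.
  by rewrite v3J /h; ring.
have [ra ar ba ab] : [/\ herm r a = 1, herm a r = 1, herm b a = 1 & herm a b = 1].
  by rewrite /herm !mxE /= !(c1, c0) qc; split; ring.
have [br rb sr sa] : [/\ herm b r = - (om / 2), herm r b = - (om^* / 2), herm s r = w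
    & herm s a = - (2 * P)].
  by rewrite /herm !mxE /= !(c1, c0) qc; split; ring.
have sb : herm s b = 1.
  by rewrite /herm !mxE /= !(c1, c0) qc v2E; field.
have bs : herm b s = 1 by rewrite herm_conj sb c1.
have nz (v : 'cV[C]_4) k : v k 0 != 0 -> v != 0.
  by apply: contraNneq => ->; rewrite mxE.
have na : null a by split; [apply: (nz _ 0); rewrite mxE oner_eq0|case: e0].
have nr : null r by split; [apply: (nz _ 3); rewrite mxE oner_eq0|case: e0].
have nb : null b by split; [apply: (nz _ 1); rewrite mxE oner_eq0|case: e0].
have ns : null s.
  split; last by case: e0.
  by apply: (nz _ 3); rewrite mxE /= oppr_eq0 mulf_neq0 ?pnatr_eq0.
have [A [lA [k1 k10 aE] [k2 k20 rE]]] := exists_loxodromic na nr ar E.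
have [B [lB [k3 k30 bE] [k4 k40 sE]]] := exists_loxodromic nb ns bs E.
have q0 : - (om / 2) != 0 by rewrite oppr_eq0 mulf_neq0 ?invr_eq0 ?pnatr_eq0.
have p0 : - (2 * P) != 0 by rewrite oppr_eq0 mulf_neq0 ?pnatr_eq0.
exists A, B; split=> //.
  rewrite /X_defined /cross_defined aE rE bE sE !hermE ra ar sb sa br.
  by split; rewrite !mulf_neq0 ?conjC_eq0 ?oner_eq0.
rewrite /X1 /X2 /X3 aE rE bE sE !crossZ // /cross ra ar ba ab sb sa br rb sr.
congr (_, _, _).
- by field.
- by field.
- by rewrite wE; field; rewrite P0 om0.
Qed.

End Realization.

(** * Polynomial maps and immersions *)

(** The norm of a matrix is the maximum over its finitely many entries. *)
Lemma continuous_mx (R : realType) (T : topologicalType) (m n : nat)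
    (F : T -> 'M[R]_(m, n)) :
  (forall i j, continuous (fun y => F y i j)) -> continuous F.
Proof.
move=> h x; apply/cvgrPdist_le => e e0; near=> y.
rewrite [leLHS]/Num.Def.normr /= mx_normrE (bigmax_le _ (ltW e0)) //= => i _.
rewrite !mxE; move: i; near: y; apply: filter_forall => /= i.
exact: ((cvgrPdist_le _ _).1 (h i.1 i.2 x)).
Unshelve. all: by end_near.
Qed.

Section PolynomialMaps.
Variables (R : realType) (d : nat).
Implicit Types (x v : 'rV[R]_d).

(** Syntax makes a directional derivative another polynomial expression, which settles the
    continuity of the Jacobian and lets its entries be obtained by computation. *)
Inductive poly_expr : Type :=
  | PVar of 'I_d
  | PConst of R
  | PAdd of poly_expr & poly_expr
  | PMul of poly_expr & poly_expr
  | POpp of poly_expr.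

Fixpoint peval p x : R :=
  match p with
  | PVar i => x 0 i
  | PConst c => c
  | PAdd p q => peval p x + peval q x
  | PMul p q => peval p x * peval q x
  | POpp p => - peval p x
  end.

Fixpoint pdiff v p : poly_expr :=
  match p with
  | PVar i => PConst (v 0 i)
  | PConst c => PConst 0
  | PAdd p q => PAdd (pdiff v p) (pdiff v q)
  | PMul p q => PAdd (PMul p (pdiff v q)) (PMul q (pdiff v p))
  | POpp p => POpp (pdiff v p)
  end.

Lemma peval_differentiable p x : differentiable (peval p) x.
Proof.
elim: p => [i|c|p hp q hq|p hp q hq|p hp] /=.
- exact: differentiable_coord.
- exact: differentiable_cst.
- exact: differentiableD.
- exact: differentiableM.
- exact: differentiableN.
Qed.

Lemma peval_continuous p : continuous (peval p).
Proof. by move=> x; exact/differentiable_continuous/peval_differentiable. Qed.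

Lemma is_derive_peval p x v : is_derive x v (peval p) (peval (pdiff v p) x).
Proof.
elim: p => [i|c|p hp q hq|p hp q hq|p hp] /=.
- have dv : derivable (id : 'rV[R]_d -> 'rV[R]_d) x v by exact: derivable_id.
  apply: DeriveDef; first by have /derivable_mxP := dv.
  have := congr1 (fun M : 'rV_d => M 0 i) (derive_mx dv).
  by rewrite derive_id mxE => ->.
- exact: is_derive_cst.
- exact: is_derive_add.
- exact: is_derive_mul.
- exact: is_derive_opp.
Qed.

Lemma open_peval_gt0 p : open [set x | 0 < peval p x].
Proof.
have /continuousP h := @peval_continuous p.
by apply: (h [set y | 0 < y]); exact: open_gt.
Qed.

Variables (N : nat) (ps : 'I_N -> poly_expr).

Definition poly_map x : 'rV[R]_N := \row_k peval (ps k) x.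

Lemma poly_map_differentiable x : differentiable poly_map x.
Proof.
(* A sum of scalar functions times basis vectors reduces differentiability to that of each entry. *)
have -> : poly_map = \sum_k (fun y => peval (ps k) y *: (delta_mx 0 k : 'rV[R]_N)).
  apply/funext => y; rewrite fct_sumE; apply/rowP => j; rewrite mxE summxE.
  rewrite (bigD1 j) //= !mxE !eqxx mulr1 big1 ?addr0 // => k kj.
  by rewrite !mxE eqxx eq_sym (negPf kj) mulr0.
apply: differentiable_sum => k; apply: differentiableZl.
exact: peval_differentiable.
Qed.

Lemma mul_jacobian_poly_map x v k :
  (v *m jacobian poly_map x) 0 k = peval (pdiff v (ps k)) x.
Proof.
have dx := poly_map_differentiable x.
rewrite -deriveEjacobian // derive_mx; last exact: diff_derivable.
rewrite mxE (_ : (fun y => poly_map y 0 k) = peval (ps k)).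
  by have [_ ->] := is_derive_peval (ps k) x v.
by apply/funext => y; rewrite mxE.
Qed.

(** The entries of [v *m jacobian] are the evaluated [pdiff v], so the hypothesis says that the
    Jacobian has trivial left kernel. *)
Lemma poly_map_immersion (U : set 'rV[R]_d) : open U ->
  (forall x v, U x -> (forall k, peval (pdiff v (ps k)) x = 0) -> v = 0) ->
  C1_immersion U poly_map.
Proof.
move=> oU inj; split=> //.
- by move=> x _; exact: poly_map_differentiable.
- move=> x _; apply: continuous_mx => i j y.
  rewrite (_ : (fun z => _) = peval (pdiff (delta_mx 0 i) (ps j))).
    exact: peval_continuous.
  by apply/funext => z; rewrite -mul_jacobian_poly_map -rowE [RHS]mxE.
- move=> x /set_mem Ux; apply: inj_row_free => v hv; apply: (inj x) => // k.
  by rewrite -mul_jacobian_poly_map hv mxE.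
Qed.

End PolynomialMaps.

(** * Lower bound on the dimension *)

Section Lower.
Variables (R : realType) (E : eigenframe R).
Local Notation expr := (poly_expr R 15).

Local Notation p k := (@PVar R 15 k).
Local Notation sub e f := (PAdd e (POpp f)).

(* X1 = P (1 - it), X2 = z P (1 + it), X3 = z, with P = p 6 + i p 7,
   z = p 8 + i p 9 and t = p 10. *)
Definition x1_re : expr := PAdd (p 6) (PMul (p 10) (p 7)).
Definition x1_im : expr := sub (p 7) (PMul (p 10) (p 6)).
Definition pom_re : expr := sub (p 6) (PMul (p 10) (p 7)).
Definition pom_im : expr := PAdd (p 7) (PMul (p 10) (p 6)).
Definition x2_re : expr := sub (PMul (p 8) pom_re) (PMul (p 9) pom_im).
Definition x2_im : expr := PAdd (PMul (p 8) pom_im) (PMul (p 9) pom_re).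

(** Variables 0 to 5 stand for the traces and sigmas, 6 to 10 for the cross-ratio family, 11 to 14
    for [alpha] and [beta]; the order is that of [real_coordinates]. *)
Definition coords : 'I_16 -> expr := fun k =>
  nth (p 0) [:: p 0; p 1; p 2; p 3; p 4; p 5; x1_re; x1_im; x2_re; x2_im;
                p 8; p 9; p 11; p 12; p 13; p 14] k.

(* The hypothesis of [realize_cross_ratios]. *)
Definition gap : expr :=
  let v2_re := sub (PConst _ 1) (PAdd x2_re x1_re) in
  let v2_im := PAdd x2_im x1_im in
  sub (PMul (PConst _ 4) (PAdd (PMul x2_re (p 6)) (PMul x2_im (p 7))))
      (PAdd (PMul v2_re v2_re) (PMul v2_im v2_im)).

(** Strict polynomial inequalities keep the domain open. Besides the gap, the real parts of [P],
    [z], [alpha], [beta] are required to be positive, so that none of these vanishes. *)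
Definition chart : set 'rV[R]_15 :=
  [set x | 0 < peval gap x] `&` [set x | 0 < peval (p 6) x] `&`
  [set x | 0 < peval (p 8) x] `&` [set x | 0 < peval (p 11) x] `&`
  [set x | 0 < peval (p 13) x].

Lemma chart_neq0 : chart !=set0.
Proof.
(* The point [P = 1/2], [z = 1], [t = 0], [alpha = beta = 1]: both [X1] and [X2] are 1/2, [v2]
   vanishes and the gap is 1. *)
exists (\row_k [:: 0; 0; 0; 0; 0; 0; 2^-1; 0; 1; 0; 0; 1; 0; 1; 0]`_k).
rewrite /chart /=; rewrite !mxE /=.
by do !split; lra.
Qed.

(** The equations are the two parts of [(a + ib)(m1 + i m2) = 0]; multiplying by [a - ib] solves
    them. *)
Lemma rotation_inj (a b m1 m2 : R) : (a == 0) = false ->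
  a * m1 - b * m2 = 0 -> a * m2 + b * m1 = 0 -> m1 = 0 /\ m2 = 0.
Proof.
move=> a0 e1 e2.
have n0 : a * a + b * b != 0.
  by rewrite paddr_eq0 -?expr2 ?sqr_ge0 // sqrf_eq0 a0.
split; apply: (mulfI n0); rewrite mulr0.
  transitivity (a * (a * m1 - b * m2) + b * (a * m2 + b * m1)); first by ring.
  by rewrite e1 e2; ring.
transitivity (a * (a * m2 + b * m1) - b * (a * m1 - b * m2)); first by ring.
by rewrite e1 e2; ring.
Qed.

(** Since [X3 = z], the variation of [z] is zero; as [z] is nonzero, [X2] then makes that of
    [P (1 + it)] vanish. Added to the variation of [X1 = P (1 - it)] this kills that of [P], and
    then that of [t], because the real part of [P] is positive. *)
Lemma coords_inj x v : chart x -> (forall k, peval (pdiff v (coords k)) x = 0) -> v = 0.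
Proof.
move=> [[[[_ /= x6] /= x8] _] _] h.
have h0 := h 0; have h1 := h 1; have h2 := h 2; have h3 := h 3; have h4 := h 4.
have h5 := h 5; have h6 := h 6; have h7 := h 7; have h8 := h 8; have h9 := h 9.
have h10 := h 10; have h11 := h 11; have h12 := h 12; have h13 := h 13.
have h14 := h 14; have h15 := h 15.
rewrite /= in h0 h1 h2 h3 h4 h5 h6 h7 h8 h9 h10 h11 h12 h13 h14 h15.
rewrite h10 h11 !mulr0 !addr0 in h8 h9.
have [m10 m20] := rotation_inj (gt_eqF x8) h8 h9.
have v6 : v 0 6 = 0 by move: h6 m10; lra.
have v7 : v 0 7 = 0 by move: h7 m20; lra.
have v10 : v 0 10 = 0.
  have /eqP : x 0 6 * v 0 10 = 0 by move: h7; rewrite v6 v7; lra.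
  by rewrite mulf_eq0 gt_eqF //= => /eqP.
apply/rowP => k; rewrite mxE.
case: k => [[|[|[|[|[|[|[|[|[|[|[|[|[|[|[|//]]]]]]]]]]]]]]] Hk];
 [move: h0|move: h1|move: h2|move: h3|move: h4|move: h5|move: v6|move: v7|move: h10
 |move: h11|move: v10|move: h12|move: h13|move: h14|move: h15];
 by congr (v _ _ = 0); apply: val_inj.
Qed.

Lemma chart_image :
  poly_map coords @` chart `<=` @real_coordinates R @` parameter_space E.
Proof.
move=> _ [x [[[[gx px] zx] ax] bx] <-]; rewrite /= in gx px zx ax bx.
pose P : complex R := Complex (x 0 6) (x 0 7).
pose z : complex R := Complex (x 0 8) (x 0 9).
pose om : complex R := Complex 1 (x 0 10).
have omJ : om^* = Complex 1 (- x 0 10) by [].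
have X1E : P * om^* = Complex (peval x1_re x) (peval x1_im x).
  by rewrite omJ; apply/eqP; rewrite eq_complex /=; apply/andP; split; apply/eqP; ring.
have X2E : z * P * om = Complex (peval x2_re x) (peval x2_im x).
  by apply/eqP; rewrite eq_complex /=; apply/andP; split; apply/eqP; ring.
exists (MkParameters (Complex (x 0 0) (x 0 1)) (Complex (x 0 2) (x 0 3)) (x 0 4) (x 0 5)
  (P * om^*, z * P * om, z) (Complex (x 0 11) (x 0 12)) (Complex (x 0 13) (x 0 14))).
  split=> /=.
  - apply: (realize_cross_ratios E (v2 := 1 - z * P * om - P * om^*) _ _ erefl erefl).
    + by rewrite eq_complex /= gt_eqF.
    + by apply/eqP; rewrite omJ eq_complex /=; apply/andP; split; apply/eqP; ring.
    (* The quantity is real: [w P^* + P w^*] is twice the real part of [w P^*], which explains the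
       factor 4 in [gap]. *)
    rewrite [X in 0 < X](_ : _ = ((peval gap x)%:C)%C) ?ltcR // X1E X2E.
    have -> : P^* = Complex (x 0 6) (- x 0 7) by [].
    have cE (u v : R) : (Complex u v)^* = Complex u (- v) by [].
    rewrite !(cjD, cjN, cj1, cE); apply/eqP; rewrite eq_complex /=.
    by apply/andP; split; apply/eqP; ring.
  - by rewrite eq_complex /= gt_eqF.
  - by rewrite eq_complex /= gt_eqF.
apply/rowP => k; rewrite !mxE X1E X2E /=.
by case: k => [[|[|[|[|[|[|[|[|[|[|[|[|[|[|[|[|//]]]]]]]]]]]]]]]] Hk].
Qed.

Lemma dimension_lower : contains_submanifold (@real_coordinates R @` parameter_space E) 15.
Proof.
exists chart, (poly_map coords); split.
- exact: chart_neq0.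
- apply: poly_map_immersion; last exact: coords_inj.
  by do !apply: openI; exact: open_peval_gt0.
- exact: chart_image.
Qed.

End Lower.

Theorem corollary1p2 (R : realType) (E : eigenframe R)
    (F2 : groupType) (m n : F2) (hF : free_basis2 m n) :
  (forall rho : {multiplicative F2 -> SU31 R},
     loxodromic (rho m) -> loxodromic (rho n) ->
     non_singular E (rho m) (rho n) ->
     exists i j : 'I_2,
       [/\ R_lox E m n i j rho,
           parameter_space E (parameters_of E i j (rho m) (rho n))
         & forall rho' : {multiplicative F2 -> SU31 R},
             R_lox E m n i j rho' ->
             parameters_of E i j (rho' m) (rho' n) =
               parameters_of E i j (rho m) (rho n) ->
             conjugate rho rho']) /\
  has_real_dimension (@real_coordinates R @` parameter_space E) 15.
Proof.
split; first by move=> rho lm ln ns; exact: rigidity.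
by split; [exact: dimension_lower|exact: dimension_upper].
Qed.
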